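(* Let $\mu\in(0,\tfrac12]$ and let $(\bm{\eta}_t)_{t\ge 0}=\big((\eta_t(v))_{v\in\mathbb{Z}}\big)_{t\ge0}$ be the compass model on $\mathbb{Z}$ with parameter $\mu$, started from $(\eta_0(v))_{v\in\mathbb{Z}}$ i.i.d. uniformly distributed on $\mathcal{S}=(-1,1]$. Then the following hold. (Weak consensus in mean) For every $v\in\mathbb{Z}$, $\lim_{t\to\infty}\mathbb{E}\big[d(\eta_t(v),\eta_t(v+1))\big]=0$. (No strong consensus in probability) There is no $\mathcal{S}$-valued random variable $L$ such that for every $v\in\mathbb{Z}$, $d(\eta_t(v),L)\to 0$ in probability as $t\to\infty$.
   Context: Opinion space: $\mathcal{S}=\mathbb{R}/2\mathbb{Z}$ (a circle of perimeter 2), identified with $(-1,1]$ by unique representatives; ''$x \pmod{\mathcal{S}}$'' denotes the representative of $x$ in $(-1,1]$. The metric is $d(x,y)=\min\{|x-y|,\,2-|x-y|\}$ for $x,y\in(-1,1]$, and $\mathcal{S}$ carries the corresponding circle topology. Compass model on $\mathbb{Z}$ with parameter $\mu\in(0,\tfrac12]$: the graph has vertex set $\mathbb{Z}$ and edges $e_v=\langle v,v+1\rangle$, $v\in\mathbb{Z}$. The state space is $\mathcal{S}^{\mathbb{Z}}$ with the product topology. The edges carry independent Poisson processes of rate 1, independent of the initial configuration $\bm{\eta}_0$. When the Poisson process of an edge $\langle u,v\rangle$ has an event at time $t$, only the opinions at $u$ and $v$ change: let $\delta\in(-1,1]$ be the representative of $\eta_{t-}(v)-\eta_{t-}(u)$.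 If $\delta\neq 1$, set $\sigma=\delta$; if $\delta=1$ (diametrically opposed opinions), let $\sigma\in\{-1,+1\}$ be chosen uniformly at random, independently of everything else. Then $\eta_t(u)=\eta_{t-}(u)+\mu\sigma \pmod{\mathcal{S}}$ and $\eta_t(v)=\eta_{t-}(v)-\mu\sigma\pmod{\mathcal{S}}$. That is, both opinions move towards each other along a shortest circle arc by a fraction $\mu$ of its length. *)

(* Defs.v *)
From HB Require Import structures.
From mathcomp Require Import all_boot all_order all_algebra.
From mathcomp Require Import all_classical all_reals all_analysis.
From mathcomp Require Import lra.

Set Implicit Arguments.
Unset Strict Implicit.
Unset Printing Implicit Defensive.

Import Order.TTheory GRing.Theory Num.Theory.
Import numFieldNormedType.Exports.

Local Open Scope classical_set_scope.
Local Open Scope ring_scope.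

(* The circle R/2Z is handled through its representatives in `]-1, 1]. *)
Section circle.
Context {R : realType}.
Implicit Types x y : R.

Definition wrap x : R := x - 2 * (Num.ceil ((x - 1) / 2))%:~R.

(* The next three facts show that [wrap x] is the representative of x. *)
Lemma wrap_itv x : wrap x \in `]-1, 1].
Proof.
have := Num.Theory.ceil_itv ((x - 1) / 2); rewrite /wrap.
set c := (Num.ceil _)%:~R; rewrite intrD -/c in_itv /=.
by rewrite ltr_pdivlMr // ler_pdivrMr // => /andP[h1 h2]; apply/andP; split;
  [rewrite ltrBrDl | rewrite lerBlDr]; lra.
Qed.

Lemma wrapE x : exists k : int, wrap x = x + 2 * k%:~R.
Proof.
by exists (- Num.ceil ((x - 1) / 2)); rewrite /wrap mulrNz mulrN.
Qed.

Lemma wrap_id x : x \in `]-1, 1] -> wrap x = x.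
Proof.
rewrite in_itv /= => /andP[h1 h2]; rewrite /wrap.
suff -> : Num.ceil ((x - 1) / 2) = 0 by rewrite mulr0 subr0.
by apply/eqP; rewrite Num.Theory.ceil_eq ?num_real //; lra.
Qed.

(* Only meaningful for x, y in `]-1, 1]. *)
Definition circle_dist x y : R := Num.min `|x - y| (2 - `|x - y|).

(* Signed displacement from x towards y; [c] (a sign) decides antipodal ties. *)
Definition displacement (c x y : R) : R :=
  let delta := wrap (y - x) in if delta == 1 then c else delta.

Lemma ltrN11 : -1 < 1 :> R.
Proof. by rewrite gtrN. Qed.

End circle.

Section path.
Context {R : realType}.

(* [tau v n] is the time of the n-th event of the edge <v, v+1>, and [c v n]
   is the sign used at that event in case of a tie.  The value just before an
   event is the value at all times close enough to it on the left: locally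
   only finitely many events touch a vertex, so paths are step functions. *)
Definition compass_path (mu : R) (tau c : int -> nat -> R)
    (x : R -> int -> R) : Prop :=
  (forall (s t : R) (v : int), 0 <= s -> s <= t ->
     (forall n, ~ (s < tau (v - 1) n <= t)) ->
     (forall n, ~ (s < tau v n <= t)) ->
     x t v = x s v)
  /\
  (forall (v : int) (n : nat), \forall s \near (tau v n)^'-,
     let sigma := displacement (c v n) (x s v) (x s (v + 1)) in
     x (tau v n) v = wrap (x s v + mu * sigma) /\
     x (tau v n) (v + 1) = wrap (x s (v + 1) - mu * sigma)).

End path.

Section probability.
Context {d : measure_display} {T : measurableType d} {R : realType}.
Variable P : probability T R.

Definition mutually_independent (I : eqType) (X : I -> {RV P >-> R}) : Prop :=
  forall (J : seq I) (A : I -> set R), uniq J ->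
    (forall i, measurable (A i)) ->
    P (\big[setI/setT]_(i <- J) (X i @^-1` A i)) =
    (\prod_(i <- J) P (X i @^-1` A i))%E.

Definition has_law (X : {RV P >-> R}) (Q : set R -> \bar R) : Prop :=
  forall A : set R, measurable A -> distribution P X A = Q A.

Definition fair_sign (X : {RV P >-> R}) : Prop :=
  P (X @^-1` [set 1]) = (2^-1)%:E /\ P (X @^-1` [set -1]) = (2^-1)%:E.

Definition cvg_to0_in_probability (Z : R -> T -> R) : Prop :=
  forall e : R, 0 < e ->
    P [set w | e < `|Z t w|] @[t --> +oo] --> 0%E.

(* Event times of a rate-1 Poisson process are the partial sums of its
   i.i.d. exponential interarrival times. *)
Definition event_time (gap : int -> nat -> {RV P >-> R})
    (v : int) (n : nat) (w : T) : R := \sum_(i < n.+1) gap v i w.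

Definition randomness (eta0 : int -> {RV P >-> R})
    (gap coin : int -> nat -> {RV P >-> R})
    (i : int + (int * nat) + (int * nat)) : {RV P >-> R} :=
  match i with
  | inl (inl v) => eta0 v
  | inl (inr (v, n)) => gap v n
  | inr (v, n) => coin v n
  end.

(* Compass model on the integers with parameter mu, started from i.i.d.
   uniform opinions [eta 0 v].  Only the values [eta t v] with t >= 0 matter. *)
Record compass_model (mu : R) (gap coin : int -> nat -> {RV P >-> R})
    (eta : R -> int -> {RV P >-> R}) : Prop := CompassModel {
  compass_circle : forall t v w, 0 <= t -> eta t v w \in `]-1, 1];
  compass_init : forall v, has_law (eta 0 v) (uniform_prob (@ltrN11 R));
  compass_gap : forall v n, has_law (gap v n) (exponential_prob (1 : R));
  compass_coin : forall v n, fair_sign (coin v n);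
  compass_indep : mutually_independent (randomness (eta 0) gap coin);
  compass_dynamics : {ae P, forall w,
    compass_path mu (fun v n => event_time gap v n w) (fun v n => coin v n w)
      (fun t v => eta t v w)}
}.

End probability.

(* Main.v *)
(** Weak consensus.  Let the mass of an edge be the distance of its two opinions.
    An event at an edge of mass [x] removes [2 mu x] from it and adds at most
    [mu x] to each neighbouring edge, so the mean mass [f t], which does not
    depend on the edge by translation invariance, is nonincreasing.  If
    [m <= f t], then a block of [n] edges with [n] large has mass at least 4 with
    probability at least [3 m / 4], and with a conditional probability bounded
    below its two end edges ring not at all during the next [h] time units while
    the inner ones ring often.  The mass of the inner edges then flows to the two
    end edges, each of which holds at most 1, so a fixed amount of mass is lost.
    Hence [f] drops by a fixed amount in every interval of length [h] as long as
    [m <= f], and [f] tends to 0.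

    No strong consensus.  The law of [(eta s v, eta t v)] does not depend on [v],
    so a common limit [L] would make [eta t v] close to [L] uniformly in [v] for
    large [t], and [eta t 0] close to [eta t N] for all [N].  But up to time [t]
    some edge [k] between 0 and [N] has not rung, with probability tending to 1 as
    [N] grows; moving all initial opinions on the left of [k] to their antipodes
    preserves the law and replaces the distance [x] of [eta t 0] and [eta t N] by
    [1 - x].

    Events of the process up to time [t] are expressed through the driving
    randomness by means of edges that do not ring up to time [t]: between two of
    them the process is a finite system. *)
Require Import Defs.
From HB Require Import structures.
From mathcomp Require Import all_boot all_order all_algebra.
From mathcomp Require Import all_classical all_reals all_analysis.
From mathcomp Require Import measurable_realfun.
From mathcomp Require Import ring lra zify.

Set Implicit Arguments.
Unset Strict Implicit.
Unset Printing Implicit Defensive.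

Import Order.TTheory GRing.Theory Num.Theory.
Import numFieldNormedType.Exports.

Local Open Scope classical_set_scope.
Local Open Scope ring_scope.

(** The model is specified through its paths, so every mass balance is proved path by path on a
    finite window between two quiet edges and then averaged. The price is a margin of up to [K]
    edges at either end, about which only the bound [K] on its mass is known. The window consists of
    [q] blocks: dividing by [q] with [K] fixed removes the margins, and [K] tending to infinity then
    removes the event that a margin has no quiet edge.

    An event changes the edge masses by at most a multiple of a discrete Laplacian. Hence a weighted
    mass cannot grow as long as the weight is concave at every edge that rings; the other points of
    the weight must sit on quiet edges. All deterministic estimates are choices of such a weight.

    Independence of the clocks after time [t] from the past is obtained by resampling a single
    interarrival time. This only requires that the event in question does not feel the length of the
    gap that is running at time [t]; the silence of a guard edge during time [h] is then worth
    exactly a factor [expR (- h)]. *)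

Local Notation wrap := Defs.wrap.

(** * Arithmetic of the circle *)

Section circle.
Context {R : realType}.
Implicit Types (x y z c : R) (k : int).

Lemma wrap_bounds x : -1 < wrap x <= 1.
Proof. by have := wrap_itv x; rewrite in_itv. Qed.

Lemma wrapD2 x k : wrap (x + 2 * k%:~R) = wrap x.
Proof.
rewrite /wrap.
have -> : (x + 2 * k%:~R - 1) / 2 = (x - 1) / 2 + k%:~R by field.
rewrite ceilDrz ?intr_int // intrD intrKceil; ring.
Qed.

(** Unlike [circle_dist], this is a function of a difference of arbitrary reals. It has period 2 and
    is subadditive, so computations modulo 2 need no choice of representatives. *)
Definition arc x := `|wrap x|.

Lemma arcD2 x k : arc (x + 2 * k%:~R) = arc x.
Proof. by rewrite /arc wrapD2. Qed.

Lemma arc_ge0 x : 0 <= arc x. Proof. exact: normr_ge0. Qed.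

Lemma arc_le1 x : arc x <= 1.
Proof. by have /andP[h1 h2] := wrap_bounds x; rewrite ler_norml (ltW h1). Qed.

(** [wrap x] has modulus at most 1 and the other members of its class differ from it by at least 2,
    so its modulus is the least in the class. *)
Lemma arc_min x k : arc x <= `|x + 2 * k%:~R|.
Proof.
have [j wj] := wrapE x.
rewrite /arc; have [->|kj] := eqVneq k j; first by rewrite wj.
have -> : x + 2 * k%:~R = wrap x + 2 * (k - j)%:~R by rewrite wj intrB; ring.
have /andP[w1 w2] := wrap_bounds x.
have : 1 <= `|(k - j)%:~R| :> R.
  by rewrite -intr_norm (_ : 1 = 1%:~R) // ler_int; lia.
have := lerB_dist (2 * (k - j)%:~R) (- wrap x).
rewrite opprK normrN normrM ger0_norm // [wrap x + _]addrC => h1 h2.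
apply: le_trans h1.
have : `|wrap x| <= 1 by rewrite ler_norml w2 ltW.
lra.
Qed.

Lemma arc_le x : arc x <= `|x|.
Proof. by have := arc_min x 0; rewrite mulr0 addr0. Qed.

Lemma arcN x : arc (- x) = arc x.
Proof.
suff h y : arc (- y) <= arc y by apply/eqP; rewrite eq_le h -{1}(opprK x) h.
have [k wk] := wrapE y; rewrite {2}/arc wk.
by have := arc_min (- y) (- k); rewrite -normrN intrN mulrN opprD !opprK.
Qed.

Lemma arcD x y : arc (x + y) <= arc x + arc y.
Proof.
have [j wj] := wrapE x; have [k wk] := wrapE y.
rewrite {2 3}/arc wj wk; apply: le_trans (ler_normD _ _).
have := arc_min (x + y) (j + k); rewrite intrD.
by congr (_ <= `|_|); ring.
Qed.

Lemma circle_distE x y : x \in `]-1, 1] -> y \in `]-1, 1] ->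
  circle_dist x y = arc (y - x).
Proof.
rewrite !in_itv /= => /andP[x1 x2] /andP[y1 y2]; apply/eqP.
rewrite eq_le /circle_dist; apply/andP; split; last first.
  rewrite le_min distrC arc_le /=.
  have [h|h] := leP x y.
    have := arc_min (y - x) (-1); rewrite intrN mulrN1.
    by rewrite (ler0_norm (_ : y - x - 2 <= 0)) ?ger0_norm; lra.
  have := arc_min (y - x) 1; rewrite mulr1.
  by rewrite (ger0_norm (_ : 0 <= y - x + 2)) ?ler0_norm; lra.
rewrite ge_min /arc; have [k wk] := wrapE (y - x).
have /andP[w1 w2] := wrap_bounds (y - x); rewrite wk in w1 w2 *.
move: (w1) (w2).
(* Two representatives differ by less than 2, which leaves only the corrections -1, 0 and 1. *)
have k1 : -2 < k by rewrite -(ltr_int R); lra.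
have k2 : k < 2 by rewrite -(ltr_int R); lra.
have [->|[->|->]] : k = -1 \/ k = 0 \/ k = 1 by lia.
- rewrite intrN mulrN1 distrC => h1 h2; apply/orP; right.
  by rewrite ger0_norm ?ler0_norm; lra.
- by rewrite mulr0 addr0 distrC lexx => _ _.
- rewrite mulr1 distrC => h1 h2; apply/orP; right.
  by rewrite ler0_norm ?ger0_norm; lra.
Qed.

(** The values 1 and -1 agree modulo 2, so either outcome of the coin leads from [x] to [y]. *)
Lemma displacementE c x y : c = 1 \/ c = -1 ->
  exists k, displacement c x y = y - x + 2 * k%:~R.
Proof.
move=> hc; rewrite /displacement; have [k wk] := wrapE (y - x).
case: eqP => [w1|_]; last by exists k.
rewrite w1 in wk.
by case: hc => ->; [exists k | exists (k - 1); rewrite intrB; lra].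
Qed.

Lemma norm_displacement c x y : c = 1 \/ c = -1 ->
  `|displacement c x y| = arc (y - x).
Proof.
move=> hc; rewrite /displacement /arc; case: eqP => [->|//].
by case: hc => ->; rewrite ?normrN.
Qed.

End circle.

(** * Effect of one event on the edge masses *)

Section ring_update.
Context {R : realType} (mu : R).
Implicit Types (x : int -> R) (c : R) (e k v : int).

Definition ring c e x v : R :=
  let s := displacement c (x e) (x (e + 1)) in
  if v == e then Defs.wrap (x e + mu * s)
  else if v == e + 1 then Defs.wrap (x (e + 1) - mu * s) else x v.

Definition replay (c : int -> nat -> R) (u : seq (int * nat)) x : int -> R :=
  foldl (fun y p => ring (c p.1 p.2) p.1 y) x u.

Definition gapd x k : R := arc (x (k + 1) - x k).

Lemma gapd_ge0 x k : 0 <= gapd x k. Proof. exact: arc_ge0. Qed.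
Lemma gapd_le1 x k : gapd x k <= 1. Proof. exact: arc_le1. Qed.

Hypotheses (mu_gt0 : 0 < mu) (mu_le : mu <= 2^-1).

(** At [e] the displacement becomes [(1 - 2 * mu) * s] modulo 2, with a nonnegative factor since
    [mu <= 2^-1]. A neighbouring edge has one endpoint moved by [mu * s], and the triangle
    inequality applies. The bracket is the discrete Laplacian of the indicator of [e]. *)
Lemma gapd_ring c e x k : c = 1 \/ c = -1 ->
  gapd (ring c e x) k <=
  gapd x k + mu * gapd x e * ((k == e - 1)%:R + (k == e + 1)%:R - 2 * (k == e)%:R).
Proof.
move=> hc; have [j dj] := displacementE (x e) (x (e + 1)) hc.
have nd := norm_displacement (x e) (x (e + 1)) hc.
rewrite /gapd /ring; set s := displacement _ _ _ in dj nd *.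
rewrite -nd; have nms : arc (mu * s) <= mu * `|s|.
  by rewrite (le_trans (arc_le _)) // normrM gtr0_norm.
have wr (y z : R) : exists i, wrap y - wrap z = y - z + 2 * i%:~R.
  have [i1 ->] := wrapE y; have [i2 ->] := wrapE z.
  by exists (i1 - i2); rewrite intrB; ring.
have [->|ke] := eqVneq k e.
  rewrite (_ : e + 1 == e = false); last by lia.
  rewrite (_ : e == e - 1 = false); last by lia.
  rewrite (_ : e == e + 1 = false) ?eqxx; last by lia.
  have [i ->] := wr (x (e + 1) - mu * s) (x e + mu * s).
  rewrite arcD2 -nd (_ : _ - _ - _ = (1 - 2 * mu) * s + 2 * (- j)%:~R); last first.
    by rewrite dj intrN; ring.
  rewrite arcD2 (le_trans (arc_le _)) // normrM (ger0_norm (_ : 0 <= 1 - 2 * mu)).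
    by rewrite /= mulr0n mulr1n; lra.
  by rewrite subr_ge0 mulrC -ler_pdivlMr ?mul1r.
have [->|ke1] := eqVneq k (e - 1).
  rewrite subrK eqxx (_ : (e - 1 == e + 1) = false); last by lia.
  rewrite mulr0 subr0 addr0 mulr1.
  have [i wi] := wrapE (x e + mu * s).
  rewrite wi (_ : _ - _ = x e - x (e - 1) + mu * s + 2 * i%:~R); last by ring.
  by rewrite arcD2 (le_trans (arcD _ _)) // lerD2l.
have [->|ke2] := eqVneq k (e + 1).
  rewrite (_ : (e + 1 + 1 == e) = false); last by lia.
  rewrite (_ : (e + 1 + 1 == e + 1) = false); last by lia.
  rewrite mulr0 subr0 add0r mulr1.
  have [i wi] := wrapE (x (e + 1) - mu * s).
  rewrite wi (_ : _ - _ = x (e + 1 + 1) - x (e + 1) + mu * s + 2 * (- i)%:~R); last first.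
    by rewrite intrN; ring.
  by rewrite arcD2 (le_trans (arcD _ _)) // lerD2l.
rewrite !mulr0 subr0 addr0 mulr0 addr0.
rewrite (_ : (k + 1 == e) = false); last by lia.
by rewrite (_ : (k + 1 == e + 1) = false) //; lia.
Qed.

Section weighted.
Variables (s : seq int) (th : int -> R).
Hypotheses (us : uniq s) (th0 : forall k, 0 <= th k)
  (ths : forall k, k \notin s -> th k = 0).

Definition wmass x : R := \sum_(k <- s) th k * gapd x k.

Let sum_pick e : \sum_(k <- s) th k * (k == e)%:R = th e.
Proof.
have [es|es] := boolP (e \in s); last first.
  rewrite (ths es) big1_seq // => k /andP[_ ks]; case: eqP => [ke|]; rewrite ?mulr0 //.
  by rewrite -ke ks in es.
rewrite (bigD1_seq e) //= eqxx mulr1 big1 ?addr0 // => k /negPf ->.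
by rewrite mulr0.
Qed.

(** Summation by parts: the Laplacian passes from the indicator of [e] to the weight. Since [th]
    vanishes off [s], the edges [e - 1], [e], [e + 1] may lie outside [s]. *)
Lemma wmass_ring c e x : c = 1 \/ c = -1 ->
  wmass (ring c e x) <=
  wmass x - mu * gapd x e * (2 * th e - th (e - 1) - th (e + 1)).
Proof.
move=> hc; have : wmass (ring c e x) <= \sum_(k <- s) th k * (gapd x k +
    mu * gapd x e * ((k == e - 1)%:R + (k == e + 1)%:R - 2 * (k == e)%:R)).
  by apply: ler_sum => k _; apply: ler_wpM2l => //; exact: gapd_ring.
move=> /le_trans; apply; rewrite le_eqVlt; apply/orP; left; apply/eqP.
rewrite -{1}(sum_pick e) -(sum_pick (e - 1)) -(sum_pick (e + 1)) /wmass.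
rewrite [2 * _]mulr_sumr -!sumrB mulr_sumr -sumrB; apply: eq_bigr => k _; ring.
Qed.

(** Concavity of the weight is asked only at edges that ring, so the weight may jump up next to an
    edge that stays quiet. *)
Lemma wmass_replay (c : int -> nat -> R) (u : seq (int * nat)) x :
  (forall p : int * nat, p \in u -> c p.1 p.2 = 1 \/ c p.1 p.2 = -1) ->
  (forall p : int * nat, p \in u -> th (p.1 - 1) + th (p.1 + 1) <= 2 * th p.1) ->
  wmass (replay c u x) <= wmass x.
Proof.
elim: u x => [|p u IH] x hc hu //=.
apply: (le_trans (IH _ _ _)) => [q qu|q qu|].
- by apply: hc; rewrite inE qu orbT.
- by apply: hu; rewrite inE qu orbT.
apply: le_trans (wmass_ring _ _ _) _; first by apply: hc; rewrite inE eqxx.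
rewrite gerBl; apply: mulr_ge0; first by rewrite mulr_ge0 ?gapd_ge0 // ltW.
by have := hu p; rewrite inE eqxx => /(_ isT); lra.
Qed.

End weighted.

End ring_update.

Section int_range.
Implicit Types (a k : int) (n m : nat).

Definition rng a n : seq int := [seq a + i%:Z | i <- iota 0 n].

Lemma mem_rng a n k : (k \in rng a n) = (a <= k < a + n%:Z).
Proof.
apply/mapP/idP => [[i]|h]; first by rewrite mem_iota => hi ->; lia.
by exists `|k - a|%N; rewrite ?mem_iota; lia.
Qed.

Lemma rng_uniq a n : uniq (rng a n).
Proof. by rewrite map_inj_uniq ?iota_uniq // => i j; lia. Qed.

Lemma rng_cat a n m : rng a (n + m) = rng a n ++ rng (a + n%:Z) m.
Proof.
rewrite /rng iotaD map_cat; congr (_ ++ _).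
rewrite add0n -{1}(addn0 n) iotaDl -map_comp; apply: eq_map => i /=; lia.
Qed.

Lemma sum_rng_mul (V : nmodType) (F : int -> V) q l :
  \sum_(k <- rng 0 (q * l)) F k =
  \sum_(j < q) \sum_(k <- rng (j * l)%N%:Z l) F k.
Proof.
elim: q => [|q IH]; first by rewrite big_ord0 big_nil.
by rewrite mulSn addnC rng_cat big_cat /= IH big_ord_recr /= add0r.
Qed.

End int_range.

(** * Draining the core of one block *)

Section core.
Context {R : realType} (mu : R).
Hypotheses (mu_gt0 : 0 < mu) (mu_le : mu <= 2^-1).
Variables (c0 : int) (n : nat).
Implicit Types (x : int -> R) (c : int -> nat -> R) (u : seq (int * nat)).

Let core := rng c0 n.
(** A quadratic with zeros at the guard edges [c0 - 1] and [c0 + n]. Its second difference is -2, so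
    every ring of a core edge [e] removes at least [2 * mu * gapd y e] from the weighted mass. *)
Let parabola (k : int) : R :=
  if k \in core then ((k - c0 + 1) * (c0 + n%:Z - k))%:~R else 0.

Let parabola_ge0 k : 0 <= parabola k.
Proof.
rewrite /parabola; case: ifP => //; rewrite mem_rng => h.
by rewrite ler0z mulr_ge0 //; lia.
Qed.

Let parabolaN k : k \notin core -> parabola k = 0.
Proof. by rewrite /parabola => /negPf ->. Qed.

(** The quadratic itself vanishes at both guards, so second differences on the core can be computed
    without cases. *)
Let parabolaE k : c0 - 1 <= k <= c0 + n%:Z ->
  parabola k = ((k - c0 + 1) * (c0 + n%:Z - k))%:~R.
Proof.
move=> h; rewrite /parabola mem_rng; case: ifP => // h1.
have [->|->] : k = c0 - 1 \/ k = c0 + n%:Z by lia.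
  by rewrite (_ : c0 - 1 - c0 + 1 = 0) ?mul0r //; lia.
by rewrite subrr mulr0.
Qed.

Definition coins_ok c u := forall p : int * nat, p \in u -> c p.1 p.2 = 1 \/ c p.1 p.2 = -1.

Definition off_guards u :=
  forall p : int * nat, p \in u -> p.1 != c0 - 1 /\ p.1 != c0 + n%:Z.

Definition inner x : R := \sum_(k <- core) gapd x k.

(** The indicator of the core can fail to be concave only at the two guard edges, which [u]
    avoids. *)
Lemma inner_replay c u x : coins_ok c u -> off_guards u ->
  inner (replay mu c u x) <= inner x.
Proof.
move=> hc hu.
have e y : inner y = wmass core (fun k => (k \in core)%:R) y.
  by rewrite /inner /wmass; apply: eq_big_seq => k ->; rewrite mul1r.
rewrite !e; apply: wmass_replay => //; first exact: rng_uniq.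
- by move=> k /negPf ->.
move=> p /hu; rewrite !mem_rng => -[/eqP h1 /eqP h2].
rewrite -natrM -natrD ler_nat; lia.
Qed.

(** A potential argument, by induction on the last event. A ring of a core edge [e] lowers the
    parabola mass by [2 * mu * gapd y e], while the mass on the edges that have rung so far grows by
    at most [gapd y e]: the edge [e] may join them, and once it has, their indicator is concave at
    [e], so the ring itself adds nothing. *)
Let spread_step c u x : coins_ok c u -> off_guards u ->
  2 * mu * (\sum_(k <- core | k \in map fst u) gapd (replay mu c u x) k) <=
  wmass core parabola x - wmass core parabola (replay mu c u x).
Proof.
elim/last_ind: u => [|u p IH] hc hu.
  by rewrite big1 ?mulr0 ?subrr //.
have {}IH : 2 * mu * (\sum_(k <- core | k \in map fst u) gapd (replay mu c u x) k) <=
    wmass core parabola x - wmass core parabola (replay mu c u x).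
  by apply: IH => q qu; [apply: hc|apply: hu]; rewrite mem_rcons inE qu orbT.
have cp : c p.1 p.2 = 1 \/ c p.1 p.2 = -1 by apply: hc; rewrite mem_rcons inE eqxx.
have [/eqP g1 /eqP g2] : p.1 != c0 - 1 /\ p.1 != c0 + n%:Z.
  by apply: hu; rewrite mem_rcons inE eqxx.
rewrite /replay foldl_rcons -/(replay mu c u x); set y := replay mu c u x in IH *.
have hV := wmass_ring mu_gt0 mu_le (rng_uniq c0 n) parabola_ge0 parabolaN p.1 y cp.
pose th k : R := ((k \in core) && (k \in map fst (rcons u p)))%:R.
have thE z : \sum_(k <- core | k \in map fst (rcons u p)) gapd z k = wmass core th z.
  rewrite /wmass /th big_mkcond /=; apply: eq_big_seq => k -> /=.
  by case: ifP; rewrite ?mul1r ?mul0r.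
have hS := wmass_ring mu_gt0 mu_le (rng_uniq c0 n) (th := th) _ _ p.1 y cp.
have {}hS : wmass core th (ring mu (c p.1 p.2) p.1 y) <= wmass core th y -
    mu * gapd y p.1 * (2 * th p.1 - th (p.1 - 1) - th (p.1 + 1)).
  by apply: hS => [k|k /negPf]; rewrite /th // => ->.
rewrite thE; have mu2 : 0 <= 2 * mu by rewrite mulr_ge0 // ltW.
have [pc|pc] := boolP (p.1 \in core).
  have hth : 2 * th p.1 - th (p.1 - 1) - th (p.1 + 1) >= 0.
    rewrite {1}/th pc map_rcons mem_rcons inE eqxx /= mulr1.
    have le1 k : th k <= 1 by rewrite /th lern1 leq_b1.
    by have := le1 (p.1 - 1); have := le1 (p.1 + 1); lra.
  have par : 2 * parabola p.1 - parabola (p.1 - 1) - parabola (p.1 + 1) = 2.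
    move: pc; rewrite mem_rng => pc; rewrite !parabolaE; [|lia..].
    by rewrite -[2]/(2%:~R) -!intrM -!intrB; congr (_%:~R); ring.
  have hS2 : wmass core th y <=
      \sum_(k <- core | k \in map fst u) gapd y k + gapd y p.1.
    rewrite /wmass (bigD1_seq p.1) ?rng_uniq //= {1}/th pc map_rcons mem_rcons inE eqxx mul1r.
    rewrite addrC lerD2r big_mkcond [leRHS]big_mkcond /=.
    rewrite big_seq_cond [leRHS]big_seq_cond; apply: ler_sum => k /andP[kc _].
    case: eqVneq => [_|kp] /=; first by case: ifP => // _; exact: gapd_ge0.
    rewrite /th kc map_rcons mem_rcons inE (negPf kp) /=.
    by case: ifP; rewrite ?mul1r ?mul0r.
  have g0 := gapd_ge0 y p.1.
  have : mu * gapd y p.1 * (2 * th p.1 - th (p.1 - 1) - th (p.1 + 1)) >= 0.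
    by rewrite !mulr_ge0 // ltW.
  move: hV; rewrite par => hV h0.
  have : wmass core th (ring mu (c p.1 p.2) p.1 y) <=
      \sum_(k <- core | k \in map fst u) gapd y k + gapd y p.1 by lra.
  by move/(ler_wpM2l mu2); rewrite mulrDr; lra.
(* A ring outside the core and off the guards has no neighbour in the core either, so neither
   weighted mass grows. *)
have pc1 : p.1 - 1 \notin core by move: pc; rewrite !mem_rng; lia.
have pc2 : p.1 + 1 \notin core by move: pc; rewrite !mem_rng; lia.
move: hV; rewrite !parabolaN // mulr0 !subr0 mulr0 subr0 => hV.
move: hS; rewrite {3 4 5}/th (negPf pc) (negPf pc1) (negPf pc2) /= mulr0 !subr0 mulr0 subr0 => hS.
have : wmass core th y = \sum_(k <- core | k \in map fst u) gapd y k.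
  rewrite /wmass /th [RHS]big_mkcond /=; apply: eq_big_seq => k kc.
  rewrite kc map_rcons mem_rcons inE.
  have /negPf -> /= : k != p.1 by apply: contraNneq pc => <-.
  by case: ifP; rewrite ?mul1r ?mul0r.
move=> e; rewrite e in hS.
by have := ler_wpM2l mu2 hS; lra.
Qed.

(** There are [n] core edges, each weight is a product of two factors at most [n], and a gap is at
    most 1. *)
Let parabola_mass x : 0 <= wmass core parabola x <= (n ^ 3)%:R.
Proof.
apply/andP; split; first by apply: sumr_ge0 => k _; rewrite mulr_ge0 ?gapd_ge0.
apply: (@le_trans _ _ (\sum_(k <- core) (n * n)%:R)); last first.
  by rewrite big_const_seq count_predT iter_addr_0 size_map size_iota -mulrnA ler_nat !expnS expn0 muln1 mulnA.
rewrite /wmass big_seq [leRHS]big_seq; apply: ler_sum => k kc.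
have : parabola k <= (n * n)%:R.
  rewrite /parabola kc; move: kc; rewrite mem_rng => kc.
  by rewrite -[(n * n)%:R]/((n * n)%:Z%:~R) ler_int; nia.
have := gapd_ge0 x k; have := gapd_le1 x k; have := parabola_ge0 k; nra.
Qed.

(* The parabola is a strictly concave weight, so the mass flowing through the
   core is bounded over all slots together; some slot, hence the last one,
   ends with little mass in the core. *)
Lemma inner_slots r c (y : nat -> int -> R) :
  (forall i, (i < r)%N -> exists u, [/\ coins_ok c u, off_guards u,
     forall k, k \in core -> k \in map fst u &
     forall k, k \in core -> gapd (y i.+1) k = gapd (replay mu c u (y i)) k]) ->
  2 * mu * r%:R * inner (y r) <= (n ^ 3)%:R.
Proof.
move=> hy.
suff : 2 * mu * r%:R * inner (y r) <=
    wmass core parabola (y 0%N) - wmass core parabola (y r).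
  by have /andP[_ h1] := parabola_mass (y 0%N); have /andP[h2 _] := parabola_mass (y r); lra.
elim: r hy => [|r IH] hy; first by rewrite mulr0 mul0r subrr.
have {}IH := IH (fun i ir => hy i (ltnW ir)).
have [u [hc hg hall hu]] := hy r (ltnSn r).
have e1 : inner (y r.+1) = inner (replay mu c u (y r)) by apply: eq_big_seq.
have e2 : wmass core parabola (y r.+1) = wmass core parabola (replay mu c u (y r)).
  by apply: eq_big_seq => k /hu ->.
have := spread_step (y r) hc hg.
rewrite -big_filter (_ : [seq _ <- _ | _] = core); last first.
  by apply/all_filterP/allP.
rewrite -/(inner _) -e2 -e1 => h1.
(* The core mass never grows, so the first [r] slots may be charged with the smaller final mass
   instead of their own. *)
have h2 : inner (y r.+1) <= inner (y r) by rewrite e1; exact: inner_replay.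
have : 2 * mu * r%:R * inner (y r.+1) <= 2 * mu * r%:R * inner (y r).
  by rewrite ler_wpM2l // !mulr_ge0 // ltW.
by rewrite -addn1 natrD; lra.
Qed.

End core.

(** * Mass balance of a long window *)

Section blocks.
Context {R : realType} (mu : R).
Hypotheses (mu_gt0 : 0 < mu) (mu_le : mu <= 2^-1).
Variables (q l K : nat) (a b : int) (good : pred 'I_q).
Hypotheses (l2 : (2 <= l)%N) (haK : - K%:Z <= a) (ha : a < 0) (hb : (q * l)%N%:Z <= b)
  (hbK : b < (q * l)%N%:Z + K%:Z).
Implicit Types (x : int -> R) (c : int -> nat -> R) (u : seq (int * nat)).

Let block (j : nat) : seq int := rng (j * l)%N%:Z l.
Let blocked (k : int) := [exists j : 'I_q, good j && (k \in block j)].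
(** This weight is not concave at most at [a], [b] and the end edges of good blocks, and none of
    these rings. *)
Let th (k : int) : R := ((a < k < b) && ~~ blocked k)%:R.
Let window := rng (- K%:Z) (K + (q * l) + K).

Let blockedE (j : 'I_q) k : k \in block j -> blocked k = good j.
Proof.
move=> kj; apply/existsP/idP => [[i /andP[gi]]|gj]; last by exists j; rewrite gj.
rewrite !mem_rng in kj * => ki; suff -> : j = i by [].
by apply/val_inj => /=; nia.
Qed.

Let in_window (j : 'I_q) k : k \in block j -> 0 <= k < (q * l)%N%:Z.
Proof. by rewrite mem_rng; have := ltn_ord j; nia. Qed.

Let massE x : wmass window th x =
  \sum_(k <- rng (- K%:Z) K) th k * gapd x k +
  \sum_(j < q) (if good j then 0 else \sum_(k <- block j) gapd x k) +
  \sum_(k <- rng (q * l)%N%:Z K) th k * gapd x k.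
Proof.
rewrite /wmass /window !rng_cat !big_cat /= addNr (_ : - _ + _ = (q * l)%N%:Z); last by lia.
congr (_ + _ + _); rewrite sum_rng_mul; apply: eq_bigr => j _.
rewrite -/(block j); case: ifP => gj.
  rewrite big_seq big1 // => k kj; rewrite /th (blockedE kj) gj andbF; exact: mul0r.
apply: eq_big_seq => k kj; rewrite /th (blockedE kj) gj andbT.
have /andP[k0 kN] := in_window kj.
by rewrite (lt_le_trans ha k0) (lt_le_trans kN hb) mul1r.
Qed.

(** The two margins are the source of the error [2 * K%:R] in the balance, which does not grow with
    [q]. *)
Let margin x (s : seq int) : size s = K ->
  0 <= \sum_(k <- s) th k * gapd x k <= K%:R.
Proof.
move=> sK; apply/andP; split.
  by apply: sumr_ge0 => k _; rewrite mulr_ge0 ?gapd_ge0.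
rewrite -sK -sum1_size natr_sum; apply: ler_sum => k _.
by rewrite mulr_ile1 ?gapd_ge0 ?gapd_le1 // /th ?lern1 ?leq_b1.
Qed.

(* The mass outside the good blocks cannot increase, since the guards of a good
   block do not ring; the mass in a good block drops from at least 4 to 3. *)
Lemma block_drop c u x x' : coins_ok c u ->
  (forall p : int * nat, p \in u -> a < p.1 < b) ->
  (forall (p : int * nat) (j : 'I_q), p \in u -> good j ->
     p.1 != (j * l)%N%:Z /\ p.1 != (j * l)%N%:Z + l%:Z - 1) ->
  (forall k, a < k < b -> gapd x' k = gapd (replay mu c u x) k) ->
  (forall j : 'I_q, good j -> 4 <= \sum_(k <- rng (j * l)%N%:Z l) gapd x k) ->
  (forall j : 'I_q, good j -> \sum_(k <- rng (j * l)%N%:Z l) gapd x' k <= 3) ->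
  \sum_(k <- rng 0 (q * l)) gapd x' k + \sum_(j < q) (good j)%:R <=
  \sum_(k <- rng 0 (q * l)) gapd x k + 2 * K%:R.
Proof.
move=> hc hab hguard hx' h4 h3.
have : wmass window th x' <= wmass window th x.
  have -> : wmass window th x' = wmass window th (replay mu c u x).
    apply: eq_bigr => k _; rewrite /th; case: (boolP (a < k < b)) => [/hx' -> //|_].
    by rewrite !mul0r.
  apply: wmass_replay => //; first exact: rng_uniq.
    by move=> k; rewrite mem_rng /th => kw; case: (boolP (a < k < b)) => //=; lia.
  move=> p pu; have pab := hab _ pu; rewrite -natrM -natrD ler_nat.
  rewrite pab /=; have [|_] := boolP (blocked p.1); last first.
    by rewrite muln1 (leq_add (leq_b1 _) (leq_b1 _)).
  case/existsP => j /andP[gj pj]; have [/eqP g1 /eqP g2] := hguard _ _ pu gj.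
  have out k : k \in block j -> ~~ blocked k = false by move=> /blockedE ->; rewrite gj.
  move: pj; rewrite mem_rng => pj.
  by rewrite !out ?andbF // mem_rng; lia.
rewrite !massE => hle.
have sz m : size (rng m K) = K by rewrite size_map size_iota.
have /andP[l1 _] := margin x' (sz (- K%:Z)).
have /andP[l3 _] := margin x' (sz (q * l)%N%:Z).
have /andP[_ l4] := margin x (sz (- K%:Z)).
have /andP[_ l5] := margin x (sz (q * l)%N%:Z).
have h5 : \sum_(j < q) (if good j then 0 else \sum_(k <- block j) gapd x k) + 
   \sum_(j < q) 4 * (good j)%:R <= \sum_(j < q) \sum_(k <- block j) gapd x k.
  rewrite -big_split /=; apply: ler_sum => j _; case: ifP => [/h4|_].
    by rewrite add0r mulr1.
  by rewrite mulr0 addr0.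
have h6 : \sum_(j < q) \sum_(k <- block j) gapd x' k <=
   \sum_(j < q) (if good j then 0 else \sum_(k <- block j) gapd x' k) + 
   \sum_(j < q) 3 * (good j)%:R.
  rewrite -big_split /=; apply: ler_sum => j _; case: ifP => [/h3|_].
    by rewrite add0r mulr1.
  by rewrite mulr0 addr0.
rewrite !sum_rng_mul; move: h5 h6; rewrite -!mulr_sumr; lra.
Qed.

End blocks.

(** * Event words and paths *)

Section words.
Context {R : realType} (mu : R).
Implicit Types (tau : int -> nat -> R) (a b v e : int) (s t : R) (x y : int -> R)
  (c : int -> nat -> R) (u : seq (int * nat)).

Definition quiet tau s t e := forall m, ~ (s < tau e m <= t).

Definition earlier tau (p r : int * nat) := tau p.1 p.2 < tau r.1 r.2.

(* The second clause also covers the edges a and b, which the third one excludes: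
   these two edges are quiet during ]s, t]. *)
Definition word tau a b s t u :=
  [/\ sorted (earlier tau) u,
      forall e m, a <= e <= b -> s < tau e m <= t -> (e, m) \in u &
      forall p : int * nat, p \in u -> a < p.1 < b /\ s < tau p.1 p.2 <= t].

Lemma earlier_trans tau : transitive (earlier tau).
Proof. by move=> p q r; exact: lt_trans. Qed.

(** An edge [e] with [a < e < b] joins [e] and [e + 1], both in []a, b]]; such events neither read
    nor write any other vertex. *)
Lemma replay_local c u a b x y :
  (forall p : int * nat, p \in u -> a < p.1 < b) -> (forall v, a < v <= b -> x v = y v) ->
  forall v, a < v <= b -> replay mu c u x v = replay mu c u y v.
Proof.
elim: u x y => [|p u IH] x y hu hxy v hv /=; first exact: hxy.
apply: IH => // [q qu|w hw]; first by apply: hu; rewrite inE qu orbT.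
have hp : a < p.1 < b by apply: hu; rewrite inE eqxx.
by rewrite /ring !hxy //; lia.
Qed.

Lemma vertex_edges a b v : a < v <= b -> a <= v - 1 <= b /\ a <= v <= b.
Proof. by split; lia. Qed.

(** Induction on the first event of the word. Up to it no edge touching the window rings, so the
    state is constant there; at it the jump rule gives one [ring]; the rest of the word is then
    replayed from that time. *)
Lemma path_replay tau c (x : R -> int -> R) a b s t u :
  compass_path mu tau c x -> 0 <= s -> s <= t -> word tau a b s t u ->
  forall v, a < v <= b -> x t v = replay mu c u (x s) v.
Proof.
move=> [hconst hjump]; elim: u s => [|[e n] u IH] s s0 st [hsort hall hin] v hv.
  have [vl vr] := vertex_edges hv.
  by apply: hconst => // n hn; [have := hall _ _ vl hn | have := hall _ _ vr hn].
have [/= hab /andP[sT Tt]] := hin (e, n) (mem_head _ _).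
have hmin p : p \in u -> tau e n < tau p.1 p.2.
  have := order_path_min (earlier_trans (tau := tau)) hsort.
  by move=> /allP h /h.
have first e' m : a <= e' <= b -> s < tau e' m <= t ->
    (e', m) = (e, n) \/ tau e n < tau e' m.
  move=> he hm; have := hall _ _ he hm; rewrite inE.
  by case/orP => [/eqP|/hmin]; [left|right].
have none r e' m : r <= tau e n -> a <= e' <= b -> s < tau e' m <= r ->
    (e', m) = (e, n) /\ r = tau e n.
  move=> rT he /andP[sm mr]; have mt := le_trans (le_trans mr rT) Tt.
  have := first e' m he; rewrite sm mt => /(_ isT)[[ee en]|Tm].
    by rewrite ee en in mr *; split => //; apply/eqP; rewrite eq_le rT.
  by have := lt_le_trans Tm (le_trans mr rT); rewrite ltxx.
have before r w : s <= r -> r < tau e n -> a < w <= b -> x r w = x s w.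
  move=> sr rT hw; have [vl vr] := vertex_edges hw.
  apply: hconst => // m hm.
    by have [_ rE] := none _ _ _ (ltW rT) vl hm; move: rT; rewrite rE ltxx.
  by have [_ rE] := none _ _ _ (ltW rT) vr hm; move: rT; rewrite rE ltxx.
have [eb eb1] : a < e <= b /\ a < e + 1 <= b by clear -hab; split; lia.
have jump w : a < w <= b -> x (tau e n) w = ring mu (c e n) e (x s) w.
  move=> hw; rewrite /ring.
  (* The jump rule speaks of times close to the event on the left. One such time after [s] is
     picked, and there the state is still that of time [s]. *)
  have : \forall r \near (tau e n)^'-, s < r by apply: nbhs_left_gt.
  move=> /(filterI (hjump e n)) /(filterI (nbhs_left_lt (tau e n))) /filter_ex[r /= [rT []]].
  move=> + sr.
  rewrite (before r e (ltW sr) rT eb) (before r (e + 1) (ltW sr) rT eb1).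
  move=> [h1 h2]; case: eqVneq => [->//|we]; case: eqVneq => [->//|we1].
  have [vl vr] := vertex_edges hw.
  apply: hconst => // [|m hm|m hm]; first exact: ltW.
    have [[/eqP ee _] _] := none _ _ _ (lexx _) vl hm.
    by rewrite subr_eq (negPf we1) in ee.
  have [[/eqP ee _] _] := none _ _ _ (lexx _) vr hm.
  by rewrite (negPf we) in ee.
rewrite (IH (tau e n) (ltW (le_lt_trans s0 sT)) Tt _ v hv) /=; last first.
  split; first exact: path_sorted hsort.
    move=> e' m he' /andP[Tm mt]; have := hall e' m he'.
    rewrite (lt_trans sT Tm) mt inE => /(_ isT) /orP[/eqP[ee mm]|//].
    by rewrite ee mm ltxx in Tm.
  move=> p pu; have [] := hin p; first by rewrite inE pu orbT.
  by rewrite (hmin _ pu) => -> /andP[_ ->].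
apply: (@replay_local _ _ a b) => // p pu.
by have [] := hin p; first by rewrite inE pu orbT.
Qed.

Definition no_tie tau := forall e e' n m, e != e' -> tau e n <> tau e' m.

(** Almost sure properties of the clocks; together they make the events of a finite window up to a
    given time a finite, strictly ordered list. *)
Definition regular tau := [/\ forall e, 0 < tau e 0%N, forall e n, tau e n < tau e n.+1,
  forall e t, exists n, t < tau e n & no_tie tau].

Lemma regular_le tau e : regular tau -> {mono tau e : m n / (m <= n)%N >-> m <= n}.
Proof. by move=> [_ h _ _]; exact: Order.NatMonotonyTheory.incnP (h e). Qed.

Lemma word_exists tau a b s t : regular tau -> a < b ->
  quiet tau s t a -> quiet tau s t b -> exists u, word tau a b s t u.
Proof.
move=> rt ab qa qb; have [_ _ hunb htie] := rt.
have /choice[f hf] e := hunb e t.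
pose N := (\max_(e <- rng a `|b - a|) f e)%N.
pose late (p : int * nat) := s < tau p.1 p.2 <= t.
pose L := [seq p <- [seq (e, m) | e <- rng a `|b - a|, m <- iota 0 N] | late p].
exists (sort (fun p r => tau p.1 p.2 <= tau r.1 r.2) L).
have memL p : (p \in L) = late p && [&& a <= p.1, p.1 < b & (p.2 < N)%N].
  rewrite mem_filter; congr (_ && _).
  apply/allpairsP/idP => [[[e m] /= [he hm ->]]|h] /=.
    by move: he hm; rewrite mem_rng mem_iota; lia.
  by exists p; rewrite mem_rng mem_iota; case: p h => e m /= h; split => //; lia.
have uL : uniq L.
  rewrite filter_uniq // allpairs_uniq ?rng_uniq ?iota_uniq //.
  by move=> [? ?] [? ?] _ _ /= [-> ->].
split.
- rewrite -[sorted _ _]/(sorted (relpre (fun p : int * nat => tau p.1 p.2) <%R) _).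
  rewrite -sorted_map.
  rewrite lt_sorted_uniq_le; apply/andP; split.
    rewrite map_inj_in_uniq ?sort_uniq // => -[e m] [e' m'] _ _ /= h.
    have [ee|ne] := eqVneq e e'; last by case: (htie _ _ m m' ne).
    congr (_, _) => //; apply/eqP; rewrite eqn_leq -!(regular_le e rt).
    by rewrite [in tau e m']ee h lexx.
  rewrite sorted_map; apply: sort_sorted => p r; exact: le_total.
- move=> e m he hm; rewrite mem_sort memL /late hm /=.
  have ea : e != a by apply/eqP => ea; apply: (qa m); rewrite -ea.
  have eb : e != b by apply/eqP => eb; apply: (qb m); rewrite -eb.
  have -> /= : a <= e by lia.
  have -> /= : e < b by lia.
  have fN : (f e <= N)%N by apply: leq_bigmax_seq => //; rewrite mem_rng; lia.
  apply: leq_trans fN; rewrite ltnNge -(regular_le e rt) -ltNge.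
  by apply: le_lt_trans (hf e); case/andP: hm.
- move=> p; rewrite mem_sort memL => /andP[pl /and3P[ap pb _]]; rewrite -/(late p) pl pb.
  have /negPf pa : p.1 != a by apply/eqP => pa; apply: (qa p.2); rewrite -pa.
  by rewrite lt_neqAle eq_sym pa ap.
Qed.

(** A word sees the clocks only up to time [t]. This lets a gap that ends after [t] be resampled
    without changing the word. *)
Lemma word_agree tau tau' a b s t u :
  (forall e m, (tau e m <= t) || (tau' e m <= t) -> tau e m = tau' e m) ->
  word tau a b s t u -> word tau' a b s t u.
Proof.
move=> h [hsort hall hin].
have hin' p : p \in u -> tau p.1 p.2 = tau' p.1 p.2.
  by move=> /hin [_ /andP[_ pt]]; apply: h; rewrite pt.
split.
- apply: (sub_in_sorted (P := mem u)) hsort; last exact/allP.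
  by move=> p r pu ru; rewrite /earlier !hin'.
- move=> e m he hm; apply: hall => //; rewrite h //.
  by move/andP: hm => [_ ->]; rewrite orbT.
- by move=> p pu; rewrite -hin' //; exact: hin.
Qed.

End words.

(** * The driving randomness as a point of a product space *)

Section cylinders.
Context {R : realType} {I : choiceType}.

Definition cylinder (J : seq I) (A : I -> set R) : set (I -> R) :=
  [set y | forall j, j \in J -> A j (y j)].

Definition cylinders : set (set (I -> R)) :=
  [set C | exists J A, (forall i, measurable (A i)) /\ C = cylinder J A].

(** The product space of copies of [R] indexed by [I], with the product sigma-algebra. *)
Definition config := g_sigma_algebraType cylinders.

HB.instance Definition _ := Measurable.on config.

Lemma cylinderI J A J' A' : cylinder J A `&` cylinder J' A' =
  cylinder (J ++ J') (fun i => (if i \in J then A i else setT) `&`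
                              (if i \in J' then A' i else setT)).
Proof.
apply/seteqP; split=> y /=.
  move=> [h h'] j; rewrite mem_cat => jJ; split.
    by case: ifP => // /h.
  by case: ifP => // /h'.
move=> h; split=> j jJ; have := h j; rewrite mem_cat jJ ?orbT => /(_ isT) [].
  by [].
by [].
Qed.

Lemma setI_closed_cylinders : setI_closed cylinders.
Proof.
move=> _ _ [J [A [mA ->]]] [J' [A' [mA' ->]]].
rewrite cylinderI; eexists; eexists; split; last by [].
by move=> i /=; apply: measurableI; case: ifP.
Qed.

Lemma cylinder_measurable J (A : I -> set R) : (forall i, measurable (A i)) ->
  measurable (cylinder J A : set config).
Proof. by move=> mA; apply: sub_sigma_algebra; exists J, A. Qed.

Lemma measurable_coord i : measurable_fun setT (fun y : config => (y : I -> R) i).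
Proof.
move=> _ B mB; rewrite setTI.
have := @cylinder_measurable [:: i] (fun=> B) (fun=> mB).
congr (measurable _); apply/seteqP; split => y /= h; last first.
  by move=> j; rewrite inE => /eqP ->.
by apply: h; rewrite inE.
Qed.

Lemma measurable_config d (T : measurableType d) (f : T -> config) :
  (forall i, measurable_fun setT (fun w => (f w : I -> R) i)) -> measurable_fun setT f.
Proof.
move=> mf; have cE : @measurable _ config = <<s cylinders >> by [].
apply: (measurability _ cE) => _ [_ [J [A [mA ->]]] <-].
rewrite setTI; have -> : f @^-1` cylinder J A =
    \big[setI/setT]_(j <- J) ((fun w => (f w : I -> R) j) @^-1` A j).
  rewrite -bigcap_seq; apply/seteqP; split => w h j.
    by move=> jJ; exact: h.
  by move=> jJ; exact: h.
apply: bigsetI_measurable => j _; rewrite -[X in measurable X]setTI.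
exact: mf.
Qed.

(** Cylinders are stable under intersection and generate the sigma-algebra, so they determine a
    probability. *)
Lemma config_law_unique (m1 m2 : probability config R) :
  (forall J A, (forall i, measurable (A i)) -> m1 (cylinder J A) = m2 (cylinder J A)) ->
  forall E : set config, measurable E -> m1 E = m2 E.
Proof.
move=> h E mE.
have cT : cylinders setT.
  exists [::], (fun=> setT); split => //.
  by apply/seteqP; split.
apply: (@g_sigma_algebra_measure_unique _ _ config cylinders _ (fun=> setT)) => //.
- exact: sub_sigma_algebra.
- by apply/seteqP; split => // y _; exists 0%N.
- exact: setI_closed_cylinders.
- by move=> _ [J [A [mA ->]]]; exact: h.
- by move=> _; have /= -> := probability_setT m1; rewrite ltry.
Qed.

End cylinders.

(** * Joint law of an independent family and resampling of one coordinate *)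

Section joint_law.
Context {d : measure_display} {T : measurableType d} {R : realType} {I : choiceType}.
Variables (P : probability T R).
Implicit Types (X : I -> {RV P >-> R}).
Local Open Scope ereal_scope.

Definition joint X (w : T) : @config R I := fun i => X i w.

Lemma measurable_joint X : measurable_fun setT (joint X).
Proof. by apply: measurable_config => i; exact: measurable_funPT. Qed.

Lemma joint_cylinder X J (A : I -> set R) : mutually_independent X ->
  (forall i, measurable (A i)) ->
  P (joint X @^-1` cylinder J A) = \prod_(j <- undup J) P (X j @^-1` A j).
Proof.
move=> iX mA; rewrite -iX ?undup_uniq //; congr (P _).
rewrite -bigcap_seq; apply/seteqP; split => w h j.
  by move=> jJ; apply: h; rewrite -mem_undup.
by move=> jJ; apply: h; rewrite /= mem_undup.
Qed.

HB.instance Definition _ X :=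
  isMeasurableFun.Build _ _ _ _ (joint X) (measurable_joint X).

Lemma joint_law_unique X X' : mutually_independent X -> mutually_independent X' ->
  (forall i A, measurable A -> P (X i @^-1` A) = P (X' i @^-1` A)) ->
  forall E : set config, measurable E -> P (joint X @^-1` E) = P (joint X' @^-1` E).
Proof.
move=> iX iX' XX' E mE.
apply: (config_law_unique (m1 := distribution P (joint X))
  (m2 := distribution P (joint X'))) => //.
move=> J A mA; apply: (eq_trans (joint_cylinder J iX mA)).
apply: (eq_trans _ (esym (joint_cylinder J iX' mA))).
by apply: eq_bigr => j _; exact: XX'.
Qed.

Definition update (y : @config R I) i x : @config R I := fun j => if j == i then x else y j.

Lemma measurable_update i :
  measurable_fun setT (fun p : @config R I * R => update p.1 i p.2).
Proof.
apply: measurable_config => j; rewrite /update; case: eqVneq => _.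
  exact: measurable_snd.
by apply: measurableT_comp (measurable_coord j) _; exact: measurable_fst.
Qed.

Let resampled X i (p : T * R) : config := update (joint X p.1) i p.2.

Let measurable_resampled X i : measurable_fun setT (resampled X i).
Proof.
have h : measurable_fun setT (fun p : T * R => (joint X p.1, p.2)).
  apply/measurable_fun_pairP; split; last exact: measurable_snd.
  by apply: measurableT_comp (measurable_joint X) _; exact: measurable_fst.
exact: measurableT_comp (measurable_update i) h.
Qed.

HB.instance Definition _ X i :=
  isMeasurableFun.Build _ _ _ _ (resampled X i) (measurable_resampled X i).

Lemma measurable_resample X i (E : set config) : measurable E ->
  measurable_fun setT (fun w => distribution P (X i) (update (joint X w) i @^-1` E) : \bar R).
Proof.
move=> mE; have mR : measurable (resampled X i @^-1` E).
  by rewrite -[X in measurable X]setTI; exact: measurable_resampled.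
rewrite (_ : (fun w => _) =
    (fun w => distribution P (X i) (xsection (resampled X i @^-1` E) w))).
  exact: measurable_fun_xsection.
apply/funext => w; congr (distribution _ _ _).
by apply/seteqP; split => x; rewrite /xsection /= inE.
Qed.

(** Replacing coordinate [i] by an independent copy preserves the joint law, as is checked on
    cylinders; the integral is the section formula for the product measure. *)
Lemma resample X i (E : set config) : mutually_independent X -> measurable E ->
  P (joint X @^-1` E) =
  \int[P]_w distribution P (X i) (update (joint X w) i @^-1` E).
Proof.
move=> iX mE.
pose Q := (P \x distribution P (X i))%E.
suff -> : P (joint X @^-1` E) = Q (resampled X i @^-1` E).
  by apply: eq_integral => w _; rewrite /= /xsection; congr (_ _); apply/seteqP; split => x /=; rewrite inE.
apply: (config_law_unique (m1 := distribution P (joint X))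
  (m2 := distribution Q (resampled X i))) => //.
move=> J A mA; apply: (eq_trans (joint_cylinder J iX mA)).
rewrite /distribution /pushforward /=.
(* The cylinder splits into the constraints on the other coordinates and the constraint [B] on the
   fresh one, which is trivial if [i] is not in [J]. *)
pose J' := rem i (undup J).
pose B := if i \in J then A i else setT.
have mB : measurable B by rewrite /B; case: ifP.
have -> : resampled X i @^-1` cylinder J A = (joint X @^-1` cylinder J' A) `*` B.
  apply/seteqP; split => [[w x] /= h|[w x] /= [h h'] j jJ].
    split => [j|]; last first.
      by rewrite /B; case: ifP => // /h; rewrite /resampled /update /= eqxx.
    rewrite /J' rem_filter ?undup_uniq // mem_filter mem_undup => /andP[/= ji /h].
    by rewrite /resampled /update /= (negPf ji).
  rewrite /resampled /update /=; case: eqVneq => ji.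
    by move: h'; rewrite /B -ji jJ.
  by apply: h; rewrite /J' rem_filter ?undup_uniq // mem_filter /= ji mem_undup.
have mJ' : measurable (joint X @^-1` cylinder J' A).
  by rewrite -[X in measurable X]setTI; apply: measurable_joint => //; exact: cylinder_measurable.
rewrite product_measure1E // [X in _ = X * _](joint_cylinder J' iX mA).
rewrite (undup_id (s := J')) ?rem_uniq ?undup_uniq //.
rewrite /B; case: ifPn => iJ; last first.
  rewrite [X in _ * X](_ : _ = 1); last exact: probability_setT.
  by rewrite mule1 /J' rem_id ?mem_undup.
by rewrite (perm_big (i :: J')) ?perm_to_rem ?mem_undup //= big_cons muleC.
Qed.

End joint_law.

Section measurability.
Context {d : measure_display} {T : measurableType d} {R : realType}.
Implicit Types (f g : T -> R).

Lemma measurable_exists (U : countType) (F : U -> set T) :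
  (forall i, measurable (F i)) -> measurable [set x | exists i, F i x].
Proof.
move=> mF; have -> : [set x | exists i, F i x] = \bigcup_i F i.
  by apply/seteqP; split => x [i]; [exists i|move=> _; exists i].
exact: countable_bigcupT_measurable.
Qed.

Lemma measurable_forall (U : countType) (F : U -> set T) :
  (forall i, measurable (F i)) -> measurable [set x | forall i, F i x].
Proof.
move=> mF; have -> : [set x | forall i, F i x] = ~` [set x | exists i, ~ F i x].
  apply/seteqP; split => x /= h; first by move=> [i]; exact.
  by move=> i; apply: contrapT => Fi; apply: h; exists i.
by apply: measurableC; apply: measurable_exists => i; exact: measurableC.
Qed.

Lemma measurable_imply (b : Prop) (F : set T) :
  measurable F -> measurable [set x | b -> F x].
Proof.
move=> mF; have [hb|hb] := pselect b.
  by have -> : [set x | b -> F x] = F by apply/seteqP; split => x /= // /(_ hb).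
have -> : [set x | b -> F x] = setT by apply/seteqP; split => x // _ /hb.
exact: measurableT.
Qed.

Lemma measurable_imply_const (b : Prop) (F : set T) :
  measurable F -> measurable [set x | F x -> b].
Proof.
move=> mF; have [hb|hb] := pselect b.
  by have -> : [set x | F x -> b] = setT by apply/seteqP; split => // x _ _.
have -> : [set x | F x -> b] = ~` F by apply/seteqP; split => x /= h // /h.
exact: measurableC.
Qed.

Lemma measurable_conj (F G : set T) :
  measurable F -> measurable G -> measurable [set x | F x /\ G x].
Proof. exact: measurableI. Qed.

Lemma measurable_const (b : Prop) : measurable [set x : T | b].
Proof.
have [hb|hb] := pselect b.
  by have -> : [set x : T | b] = setT by apply/seteqP; split.
by have -> : [set x : T | b] = set0 by apply/seteqP; split.
Qed.

Lemma measurable_lt f g : measurable_fun setT f -> measurable_fun setT g ->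
  measurable [set x | f x < g x].
Proof.
move=> mf mg; have h : measurable_fun setT (fun x => f x < g x) by exact: measurable_fun_ltr.
by have := h measurableT [set true] I; rewrite setTI.
Qed.

Lemma measurable_le f g : measurable_fun setT f -> measurable_fun setT g ->
  measurable [set x | f x <= g x].
Proof.
move=> mf mg; have h : measurable_fun setT (fun x => f x <= g x) by exact: measurable_fun_ler.
by have := h measurableT [set true] I; rewrite setTI.
Qed.

Lemma measurable_preimage f (A : set R) : measurable_fun setT f -> measurable A ->
  measurable [set x | A (f x)].
Proof. by move=> mf mA; rewrite -[X in measurable X]setTI; exact: mf. Qed.

Lemma measurable_wrap : measurable_fun setT (@wrap R).
Proof.
apply: measurable_funB => //; apply: measurable_funM => //.
apply: nondecreasing_measurable => // x y xy.
by rewrite ler_int le_ceil // ler_pM2r ?invr_gt0 // lerB.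
Qed.

Lemma measurable_wrapT f : measurable_fun setT f -> measurable_fun setT (fun x => wrap (f x)).
Proof. exact: measurableT_comp measurable_wrap. Qed.

Lemma measurable_arc f : measurable_fun setT f -> measurable_fun setT (fun x => arc (f x)).
Proof.
move=> /measurable_wrapT mf; apply: (measurableT_comp (f := @Num.norm R R)) mf.
exact: normr_measurable.
Qed.

Lemma measurable_displacement c f g : measurable_fun setT c ->
  measurable_fun setT f -> measurable_fun setT g ->
  measurable_fun setT (fun x => displacement (c x) (f x) (g x)).
Proof.
move=> mc mf mg; have mw : measurable_fun setT (fun x => wrap (g x - f x)).
  by apply: measurable_wrapT; exact: measurable_funB.
by apply: measurable_fun_ifT => //; exact: measurable_fun_eqr.
Qed.

Lemma measurable_ring mu (c : T -> R) e (x : T -> int -> R) v : measurable_fun setT c ->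
  (forall k, measurable_fun setT (fun w => x w k)) ->
  measurable_fun setT (fun w => ring mu (c w) e (x w) v).
Proof.
move=> mc mx; rewrite /ring; have md : measurable_fun setT
    (fun w => mu * displacement (c w) (x w e) (x w (e + 1))).
  by apply: measurable_funM => //; exact: measurable_displacement.
case: (v == e); [|case: (v == e + 1) => //]; apply: measurable_wrapT.
  exact: measurable_funD.
exact: measurable_funB.
Qed.

Lemma measurable_replay mu (c : T -> int -> nat -> R) u (x : T -> int -> R) v :
  (forall e n, measurable_fun setT (fun w => c w e n)) ->
  (forall k, measurable_fun setT (fun w => x w k)) ->
  measurable_fun setT (fun w => replay mu (c w) u (x w) v).
Proof.
move=> mc; elim: u x v => [|p u IH] x v mx //=.
by apply: (IH (fun w => ring mu (c w p.1 p.2) p.1 (x w))) => k; exact: measurable_ring.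
Qed.

End measurability.

(** * Exponential and uniform laws *)

Section marginal_laws.
Context {d : measure_display} {T : measurableType d} {R : realType}.
Variable P : probability T R.
Implicit Types (X : {RV P >-> R}).

Lemma exponential_prob_set1 x : exponential_prob (1 : R) [set x] = 0%E.
Proof. by rewrite /exponential_prob integral_set1. Qed.

Lemma exponential_prob_neg : exponential_prob (1 : R) `]-oo, 0[ = 0%E.
Proof.
rewrite /exponential_prob integral0_eq // => x /=; rewrite in_itv /= => x0.
by rewrite lt0_exponential_pdf.
Qed.

Lemma exponential_gt X u : has_law X (exponential_prob 1) -> 0 <= u ->
  P (X @^-1` [set x | u < x]) = (expR (- u))%:E.
Proof.
move=> lX u0; rewrite -/(distribution P X [set x | u < x]).
have mu_itv : measurable [set x : R | u < x].
  by rewrite -set_itvoy; exact: measurable_itv.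
have -> : [set x | u < x] = ~` [set x : R | x <= u].
  by apply/seteqP; split => x /=; rewrite ltNge => /negP.
have mle : measurable [set x : R | x <= u].
  by rewrite -set_itvNyc; exact: measurable_itv.
rewrite probability_setC; last first.
  by rewrite -[X in measurable X]setTI; exact: measurable_funPT.
have expU (A B : set R) : measurable A -> measurable B -> A `&` B = set0 ->
    exponential_prob 1 (A `|` B) = (exponential_prob 1 A + exponential_prob 1 B)%E.
  by move=> mA mB AB; rewrite -!lX //; [exact: measureU|exact: measurableU].
suff e : distribution P X [set x | x <= u] = (1 - expR (- u))%:E.
  by rewrite [X in (1 - X)%E]e -EFinB; congr _%:E; ring.
rewrite lX //; have [u_gt0|] := ltP 0 u; last first.
  move=> u_le0; have -> : u = 0 by apply/eqP; rewrite eq_le u_le0.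
  rewrite oppr0 expR0 subrr.
  have -> : [set x | x <= 0] = `]-oo, 0[ `|` [set 0] :> set R.
    apply/seteqP; split => x /=; rewrite in_itv /=.
      by rewrite le_eqVlt => /orP[/eqP|]; [right|left].
    by case => [/ltW|->].
  rewrite expU // ?exponential_prob_neg ?exponential_prob_set1 ?adde0 //.
  by apply/seteqP; split => x //= []; rewrite in_itv /= => + x0; rewrite x0 ltxx.
have -> : [set x | x <= u] = `]-oo, 0[ `|` `[0, u] :> set R.
  apply/seteqP; split => x /=; rewrite !in_itv /=.
    by move=> xu; case: (ltP x 0) => x0; [left|right].
  by case => [x0|/andP[]//]; rewrite (ltW (lt_trans x0 u_gt0)).
rewrite expU //; last first.
  by apply/seteqP; split => x //= []; rewrite !in_itv /= => x0 /andP[]; rewrite leNgt x0.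
by rewrite exponential_prob_neg add0e exponential_prob_itv0c // mulN1r EFinB.
Qed.

Lemma exponential_le X u : has_law X (exponential_prob 1) -> 0 <= u ->
  P (X @^-1` [set x | x <= u]) = (1 - expR (- u))%:E.
Proof.
move=> lX u0; have -> : X @^-1` [set x | x <= u] = ~` (X @^-1` [set x | u < x]).
  by apply/seteqP; split => w /=; rewrite leNgt => /negP.
rewrite probability_setC ?(exponential_gt lX u0) //.
rewrite -[X in measurable X]setTI; apply: measurable_funPT => //.
by rewrite -set_itvoy; exact: measurable_itv.
Qed.

Lemma exponential_eq X u : has_law X (exponential_prob 1) -> P (X @^-1` [set u]) = 0%E.
Proof. by move=> lX; have := lX [set u] (measurable_set1 _); rewrite exponential_prob_set1. Qed.

Lemma lebesgue_measureDr (a : R) (A : set R) : measurable A ->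
  lebesgue_measure [set x | A (x + a)] = lebesgue_measure A.
Proof.
have mDr : measurable_fun setT (fun x : measurableTypeR R => (x + a : measurableTypeR R)).
  exact: measurable_funD.
move=> mA; rewrite -/(pushforward lebesgue_measure (fun x : measurableTypeR R => (x + a : measurableTypeR R)) A).
apply/esym/lebesgue_measure_unique => //= _ [[b c]] _ <-.
rewrite /pushforward (_ : _ @^-1` _ = `]b - a, c - a]%classic); last first.
  by apply/seteqP; split => x /=; rewrite !in_itv /= ltrBlDr lerBrDr.
rewrite !lebesgue_measure_itv /= !lte_fin ltrD2r; case: ifP => // _.
by rewrite -!EFinB; congr _%:E; ring.
Qed.

Definition antipode (x : R) : R := wrap (x + 1).

Lemma measurable_antipode : measurable_fun setT antipode.
Proof. by apply: measurable_wrapT; exact: measurable_funD. Qed.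

(** The uniform law lives on the closed interval; its left endpoint, absent from the circle, is a
    null set. *)
Lemma uniform_circleE (A : set R) : measurable A ->
  uniform_prob (@ltrN11 R) A = (2^-1%:E * lebesgue_measure (A `&` `](-1)%R, 1%R]))%E.
Proof.
move=> mA; rewrite /uniform_prob integral_uniform_pdf.
rewrite (eq_integral (fun=> 2^-1%:E)); last first.
  move=> x; rewrite inE /= in_itv /= => -[_ x1]; rewrite /uniform_pdf x1.
  by congr (_^-1)%:E; rewrite opprK.
rewrite integral_cst /=; last exact: measurableI.
congr (_ * _)%E; have -> : A `&` `[-1, 1] = (A `&` [set -1]) `|` (A `&` `]-1, 1]).
  rewrite -setIUr; congr (_ `&` _); apply/seteqP; split => x /=; rewrite !in_itv /=.
    by case: (ltgtP (-1) x) => //= [h1 h2|<-]; [right|left].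
  by case => [->|/andP[/ltW -> ->]//]; rewrite lexx /=; lra.
rewrite measureU /=; [|exact: measurableI|exact: measurableI|]; last first.
  by apply/seteqP; split => x //= [[_ ->] [_]]; rewrite in_itv /= ltxx.
rewrite (@subset_measure0 _ _ _ lebesgue_measure _ [set -1]) ?add0e //.
- exact: measurableI.
- exact: lebesgue_measure_set1.
Qed.

(** The antipodal map exchanges the half circles []-1, 0]] and []0, 1]] by translations by 1 and
    -1. *)
Lemma uniform_antipode (A : set R) : measurable A ->
  uniform_prob (@ltrN11 R) [set x | A (antipode x)] = uniform_prob (@ltrN11 R) A.
Proof.
move=> mA.
have mgA : measurable [set x | A (antipode x)].
  exact: measurable_preimage measurable_antipode mA.
rewrite !uniform_circleE //; congr (_ * _)%E.
have -> : [set x | A (antipode x)] `&` `]-1, 1] =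
   [set x | (A `&` `]0, 1]) (x + 1)] `|` [set x | (A `&` `]-1, 0]) (x - 1)].
  have wL x : -1 < x <= 0 -> antipode x = x + 1.
    by move=> ?; rewrite /antipode wrap_id // in_itv /=; lra.
  have wR x : 0 < x <= 1 -> antipode x = x - 1.
    move=> ?; rewrite /antipode (_ : x + 1 = x - 1 + 2 * 1%:~R) ?wrapD2; last by lra.
    by rewrite wrap_id // in_itv /=; lra.
  apply/seteqP; split => x /=; rewrite !in_itv /=.
    move=> [Ax x1]; have [x0|x0] := leP x 0.
      by left; split; [rewrite -wL //; lra|lra].
    by right; split; [rewrite -wR //; lra|lra].
  case=> -[Ax x1]; split; [|lra| |lra].
    by rewrite wL //; lra.
  by rewrite wR //; lra.
have mAI : measurable (A `&` `]0, 1]) by exact: measurableI.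
have mAJ : measurable (A `&` `]-1, 0]) by exact: measurableI.
have mD (a : R) B : measurable B -> measurable [set x | B (x + a)].
  by move=> mB; apply: measurable_preimage => //; exact: measurable_funD.
have mI1 := mD 1 _ mAI; have mJ1 := mD (-1) _ mAJ.
transitivity (lebesgue_measure (A `&` `]0%R, 1%R]) +
    lebesgue_measure (A `&` `](-1)%R, 0%R]))%E.
  rewrite measureU //; first by congr (_ + _)%E; exact: lebesgue_measureDr.
  by apply/seteqP; split => x //= [[_ +] [_]]; rewrite !in_itv /=; lra.
rewrite -measureU //=; last first.
  by apply/seteqP; split => x //= [[_ +] [_]]; rewrite !in_itv /=; lra.
congr lebesgue_measure; rewrite -setIUr; congr (_ `&` _).
apply/seteqP; split => x /=; rewrite !in_itv /=; first by case; lra.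
by move=> h; have [x0|x0] := leP x 0; [right|left]; lra.
Qed.

End marginal_laws.

Section almost_everywhere.
Context {d : measure_display} {T : measurableType d} {R : realType}.
Variable P : probability T R.

Lemma ae_forall_count (U : countType) (Q : U -> T -> Prop) :
  (forall u, {ae P, forall w, Q u w}) -> {ae P, forall w, forall u, Q u w}.
Proof.
move=> h; have : {ae P, forall w, forall n, if unpickle n is Some u then Q u w else True}.
  apply: ae_foralln => n; case: (unpickle n) => [u|]; first exact: h.
  exact: aeW.
by apply: filterS => w hw u; have := hw (pickle u); rewrite pickleK.
Qed.

Lemma ae_measure0 (A : set T) : measurable A -> P A = 0%E -> {ae P, forall w, ~ A w}.
Proof. by move=> mA A0; exists A; split => // w /= /contrapT. Qed.

Lemma measure_ae_eq (A B : set T) : measurable A -> measurable B ->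
  {ae P, forall w, A w <-> B w} -> P A = P B.
Proof.
move=> mA mB [N [mN N0 hN]].
have h (C D : set T) : measurable C -> measurable D ->
    (forall w, ~ N w -> C w -> D w) -> (P C <= P D)%E.
  move=> mC mD CD; rewrite -[leRHS]adde0 -N0.
  apply: le_trans (measureU2 _ mD mN); apply: le_measure; rewrite ?inE //.
    exact: measurableU.
  by move=> w Cw; have [Nw|Nw] := pselect (N w); [right|left; exact: CD].
have AB w : ~ N w -> (A w <-> B w).
  by move=> Nw; apply: contrapT => nAB; apply: Nw; exact: hN.
by apply/eqP; rewrite eq_le !h // => w /AB [].
Qed.

Lemma geometric_small (x : \bar R) (q : R) : (0 <= x)%E -> 0 <= q < 1 ->
  (forall m, (x <= (q ^+ m)%:E)%E) -> x = 0%E.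
Proof.
move=> x0 /andP[q0 q1] h; apply/eqP; rewrite eq_le x0 andbT.
have qm : (fun m => (q ^+ m)%:E) @ \oo --> 0%E.
  by apply: cvg_EFin; [exact: nearW|apply: cvg_expr; rewrite ger0_norm].
rewrite -(cvg_lim _ qm) //; apply: lime_ge; first by apply/cvg_ex; exists 0%E.
exact: nearW.
Qed.

End almost_everywhere.

(** * The family that drives the model and its law *)

Section driving.
Context {d : measure_display} {T : measurableType d} {R : realType}.
Variable P : probability T R.

Definition idx : countType := (int + (int * nat) + (int * nat))%type.
Notation conf := (@config R idx).
Implicit Types (y : conf) (e v a b : int) (n m : nat) (X : idx -> {RV P >-> R}).

Definition gap_ix e n : idx := inl (inr (e, n)).
Definition cgap y e n : R := y (gap_ix e n).
Definition ccoin y e n : R := y (inr (e, n)).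
Definition cinit y v : R := y (inl (inl v)).
Definition ctau y e n : R := \sum_(i < n.+1) cgap y e i.

Definition driving X := [/\ mutually_independent X,
  forall v, has_law (X (inl (inl v))) (uniform_prob (@ltrN11 R)),
  forall e n, has_law (X (gap_ix e n)) (exponential_prob 1) &
  forall e n, fair_sign (X (inr (e, n)))].

Lemma measurable_cgap e n : measurable_fun setT (fun y => cgap y e n).
Proof. exact: measurable_coord. Qed.

Lemma measurable_ccoin e n : measurable_fun setT (fun y => ccoin y e n).
Proof. exact: measurable_coord. Qed.

Lemma measurable_cinit v : measurable_fun setT (fun y => cinit y v).
Proof. exact: measurable_coord. Qed.

Lemma measurable_ctau e n : measurable_fun setT (fun y => ctau y e n).
Proof. by apply: measurable_sum => i; exact: measurable_cgap. Qed.

Lemma ctauS y e n : ctau y e n.+1 = ctau y e n + cgap y e n.+1.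
Proof. by rewrite /ctau big_ord_recr. Qed.

Lemma measurable_joint_preimage X (E : set conf) :
  measurable E -> measurable (joint X @^-1` E).
Proof. by move=> mE; rewrite -[X in measurable X]setTI; exact: measurable_joint. Qed.

Lemma measurable_RV (X : {RV P >-> R}) (B : set R) : measurable B -> measurable (X @^-1` B).
Proof. by move=> mB; rewrite -[X in measurable X]setTI; exact: measurable_funPT. Qed.

Let fair_sign_total (X : {RV P >-> R}) : fair_sign X ->
  P (X @^-1` ([set 1] `|` [set -1])) = 1%E.
Proof.
move=> [h1 h2]; have e : (1 = 2^-1%:E + 2^-1%:E :> \bar R)%E.
  by rewrite -EFinD; congr _%:E; field.
rewrite [RHS]e preimage_setU measureU; [|exact: measurable_RV|exact: measurable_RV|].
  by congr (_ + _)%E; [exact: h1|exact: h2].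
by rewrite -preimage_setI; clear; apply/seteqP; split => w //= [] -> ?; lra.
Qed.

Lemma fair_sign_ae (X : {RV P >-> R}) : fair_sign X ->
  {ae P, forall w, X w = 1 \/ X w = -1}.
Proof.
move=> /fair_sign_total h.
have mS : measurable (X @^-1` ([set 1] `|` [set -1])).
  by apply: measurable_RV; exact: measurableU.
have := ae_measure0 (P := P) (measurableC mS); rewrite probability_setC //.
rewrite [X in (1 - X)%E]h subee // => /(_ erefl).
by apply: filterS => w /= /contrapT.
Qed.

(** The two prescribed masses already add up to 1, so only membership of 1 and -1 in [A] matters,
    which leaves four cases. *)
Lemma fair_sign_law (X X' : {RV P >-> R}) (A : set R) : fair_sign X -> fair_sign X' ->
  measurable A -> P (X @^-1` A) = P (X' @^-1` A).
Proof.
move=> fX fX' mA.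
pose B := [set x : R | (x = 1 /\ A 1) \/ (x = -1 /\ A (-1))].
have mB : measurable B.
  apply: measurableU; apply: measurable_conj; try exact: measurable_const.
    exact: measurable_set1.
  exact: measurable_set1.
have XB (Y : {RV P >-> R}) : fair_sign Y -> P (Y @^-1` A) = P (Y @^-1` B).
  move=> fY; apply: measure_ae_eq; [exact: measurable_RV|exact: measurable_RV|].
  have := fair_sign_ae fY; apply: filterS => w /= Y1; split.
    by case: Y1 => -> ?; [left|right].
  by move=> [[-> ?]|[-> ?]].
rewrite !XB //; have [A1|A1] := pselect (A 1); have [A2|A2] := pselect (A (-1)).
- have -> : B = [set 1] `|` [set -1].
    by apply/seteqP; split => x /=; [case=> -[]; [left|right]|case=> ->; [left|right]].
  by rewrite !fair_sign_total.
- have -> : B = [set 1] by apply/seteqP; split => x /=; [by case=> -[]|by move=> ->; left].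
  by case: fX => [-> _]; case: fX' => [-> _].
- have -> : B = [set -1] by apply/seteqP; split => x /=; [by case=> -[]|by move=> ->; right].
  by case: fX => [_ ->]; case: fX' => [_ ->].
- have -> : B = set0 by apply/seteqP; split => x //= [] [].
  by rewrite !preimage_set0 !measure0.
Qed.

(** The source of both symmetries: translation and antipodal flip turn a driving family into another
    one. *)
Lemma driving_law_unique X X' : driving X -> driving X' ->
  forall E : set conf, measurable E -> P (joint X @^-1` E) = P (joint X' @^-1` E).
Proof.
move=> [iX uX gX cX] [iX' uX' gX' cX']; apply: joint_law_unique => // i A mA.
case: i => [[v|[e n]]|[e n]].
- by have := uX v A mA; have := uX' v A mA; rewrite /distribution /pushforward => -> ->.
- by have := gX e n A mA; have := gX' e n A mA; rewrite /distribution /pushforward => -> ->.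
- exact: fair_sign_law.
Qed.

End driving.

(** * Almost sure regularity of the event times *)

Section regularity.
Context {d : measure_display} {T : measurableType d} {R : realType}.
Variable P : probability T R.
Notation conf := (@config R idx).
Implicit Types (y : conf) (e v a b : int) (n m : nat).
Variables (X : idx -> {RV P >-> R}) (dX : driving X).
Notation Xi := (joint X).

Lemma gaps_le (f : nat -> idx) u m : injective f ->
  (forall i, has_law (X (f i)) (exponential_prob 1)) -> 0 <= u ->
  P (Xi @^-1` [set y | forall i, (i < m)%N -> (y : idx -> R) (f i) <= u]) =
  ((1 - expR (- u)) ^+ m)%:E.
Proof.
move=> fI lX u0; have [iX _ _ _] := dX.
have -> : [set y : conf | forall i, (i < m)%N -> (y : idx -> R) (f i) <= u] =
    cylinder [seq f i | i <- iota 0 m] (fun=> [set x : R | x <= u]).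
  apply/seteqP; split => y /= h.
    by move=> j /mapP[i]; rewrite mem_iota => /andP[_ im] ->; apply: h.
  by move=> i im; apply: h; apply: map_f; rewrite mem_iota.
have mle : measurable [set x : R | x <= u].
  by rewrite -set_itvNyc; exact: measurable_itv.
rewrite (joint_cylinder _ iX) // undup_id ?map_inj_uniq ?iota_uniq // big_map.
rewrite (eq_bigr (fun=> (1 - expR (- u))%:E)); last first.
  by move=> i _; exact: exponential_le.
by rewrite prodEFin big_const_seq count_predT size_iota iter_mulr_1.
Qed.

(** The first [m] gaps are all at most [u] with probability [q ^+ m] for some [q < 1]. Applied along
    one edge this makes its clock diverge; applied to the first gaps of a sequence of edges it finds
    a quiet one. *)
Lemma gaps_gt_ae (f : nat -> idx) u : injective f ->
  (forall i, has_law (X (f i)) (exponential_prob 1)) -> 0 <= u ->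
  {ae P, forall w, exists i, u < X (f i) w}.
Proof.
move=> fI lX u0; pose E := [set y : conf | forall i, (y : idx -> R) (f i) <= u].
have mle i : measurable [set y : conf | (y : idx -> R) (f i) <= u].
  by apply: measurable_le; [exact: measurable_coord|exact: measurable_cst].
have mE : measurable E by exact: measurable_forall.
have mEX := measurable_joint_preimage X mE.
have E0 : P (Xi @^-1` E) = 0%E.
  apply: (@geometric_small _ _ (1 - expR (- u))) => [//||m].
    by rewrite subr_ge0 -expR0 ler_expR oppr_le0 u0 /= gtrBl expR_gt0.
  rewrite -(gaps_le m fI lX u0); apply: le_measure; rewrite ?inE //.
    apply: measurable_joint_preimage; apply: measurable_forall => i.
    exact: measurable_imply (mle i).
  by move=> w h i _; exact: h.
apply: filterS (ae_measure0 mEX E0) => w /= h; apply: contrapT => hn; apply: h => i.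
by rewrite leNgt; apply/negP => ui; apply: hn; exists i.
Qed.

Lemma gaps_pos_ae : {ae P, forall w, forall p : int * nat, 0 < cgap (Xi w) p.1 p.2}.
Proof.
apply: ae_forall_count => -[e n] /=; have [_ _ gX _] := dX.
have := exponential_le (gX e n) (lexx 0); rewrite oppr0 expR0 subrr => h.
have mle : measurable (X (gap_ix e n) @^-1` [set x | x <= 0]).
  by apply: measurable_RV; rewrite -set_itvNyc; exact: measurable_itv.
by apply: filterS (ae_measure0 mle h) => w /= /negP; rewrite -ltNge.
Qed.

Lemma coins_ae : {ae P, forall w, forall p : int * nat,
  ccoin (Xi w) p.1 p.2 = 1 \/ ccoin (Xi w) p.1 p.2 = -1}.
Proof.
apply: ae_forall_count => -[e n] /=; have [_ _ _ cX] := dX.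
exact: fair_sign_ae (cX e n).
Qed.

(** Gaps are positive and beyond every index some gap exceeds 1, so the partial sums pass every
    natural number. *)
Lemma unbounded_ae : {ae P, forall w, forall e t, exists n, t < ctau (Xi w) e n}.
Proof.
have h : {ae P, forall w, forall p : int * nat, exists i, 1 < cgap (Xi w) p.1 (p.2 + i)}.
  apply: ae_forall_count => -[e n]; have [_ _ gX _] := dX.
  apply: (@gaps_gt_ae (fun i => gap_ix e (n + i)%N) 1) => // i j.
  by case=> /addnI.
apply: filterS2 gaps_pos_ae h => w pos h e t.
suff [n hn] : exists n, (`|Num.ceil t|%N)%:R < ctau (Xi w) e n.
  exists n; apply: le_lt_trans hn; rewrite (le_trans (ceil_ge t)) //.
  by rewrite -[leRHS]/((`|Num.ceil t|%N)%:Z%:~R) ler_int lez_abs.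
elim: `|Num.ceil t|%N => [|k [n hn]].
  by exists 0%N; rewrite /ctau big_ord1; have := pos (e, 0%N).
have mono m i : ctau (Xi w) e m <= ctau (Xi w) e (m + i).
  elim: i => [|i IH]; first by rewrite addn0.
  by rewrite addnS ctauS (le_trans IH) // lerDl ltW //; have := pos (e, (m + i).+1).
have [i hi] := h (e, n.+1).
exists (n.+1 + i)%N; rewrite addSn ctauS -addn1 natrD.
by rewrite ltr_leD // ?(lt_le_trans hn) // ltW // -addSn.
Qed.

Definition updated y e n x : conf := update y (gap_ix e n) x.

Lemma cgap_updated y e n x e' m :
  cgap (updated y e n x) e' m = if (e' == e) && (m == n) then x else cgap y e' m.
Proof. by rewrite /cgap /updated /update. Qed.

Lemma ctau_updated_neq y e n x e' m : e' != e ->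
  ctau (updated y e n x) e' m = ctau y e' m.
Proof.
move=> ee; rewrite /ctau; apply: eq_bigr => i _.
by rewrite cgap_updated (negPf ee).
Qed.

Lemma ctau_updated_lt y e n x m : (m < n)%N -> ctau (updated y e n x) e m = ctau y e m.
Proof.
move=> mn; rewrite /ctau; apply: eq_bigr => i _.
rewrite cgap_updated (_ : (i == n :> nat) = false) ?andbF //.
by have := ltn_ord i; lia.
Qed.

Definition last_before y e n : R := \sum_(i < n) cgap y e i.

Lemma ctau_updated_eq y e n x : ctau (updated y e n x) e n = last_before y e n + x.
Proof.
rewrite /ctau big_ord_recr /= cgap_updated !eqxx; congr (_ + _).
apply: eq_bigr => i _; rewrite cgap_updated (_ : (i == n :> nat) = false) ?andbF //.
by have := ltn_ord i; lia.
Qed.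

Lemma resample_gap (E : set conf) e n : measurable E ->
  P (Xi @^-1` E) =
  (\int[P]_w P (X (gap_ix e n) @^-1` [set x | E (updated (Xi w) e n x)]))%E.
Proof. by move=> mE; have [iX _ _ _] := dX; exact: resample. Qed.

(** With everything but gap [n] of [e] frozen, a tie forces that gap to take one prescribed value,
    and the exponential law has no atoms. *)
Lemma no_tie_ae : {ae P, forall w, no_tie (ctau (Xi w))}.
Proof.
suff : {ae P, forall w, forall q : (int * nat) * (int * nat), q.1.1 != q.2.1 ->
    ctau (Xi w) q.1.1 q.1.2 <> ctau (Xi w) q.2.1 q.2.2}.
  by apply: filterS => w h e e' n m ee; exact: (h ((e, n), (e', m))).
apply: ae_forall_count => -[[e n] [e' m]] /=.
have [->|ee] := eqVneq e e'; first by apply: aeW.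
pose E := [set y : conf | ctau y e n = ctau y e' m].
have mE : measurable E.
  have -> : E = [set y : conf | ctau y e n <= ctau y e' m] `&`
                [set y : conf | ctau y e' m <= ctau y e n].
    apply/seteqP; split => y /=; first by move=> ->.
    by move=> [h1 h2]; apply/eqP; rewrite eq_le h1.
  by apply: measurableI; apply: measurable_le; exact: measurable_ctau.
have E0 : P (Xi @^-1` E) = 0%E.
  rewrite (resample_gap e n mE) integral0_eq // => w _.
  have [_ _ gX _] := dX.
  rewrite -(exponential_eq (ctau (Xi w) e' m - last_before (Xi w) e n) (gX e n)).
  congr (P (_ @^-1` _)); apply/seteqP; split => x /=;
    rewrite /E /= ctau_updated_eq ctau_updated_neq // 1?eq_sym //; lra.
by apply: filterS (ae_measure0 (measurable_joint_preimage X mE) E0).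
Qed.

Lemma regular_ae : {ae P, forall w, regular (ctau (Xi w))}.
Proof.
apply: filterS3 gaps_pos_ae unbounded_ae no_tie_ae => w pos unb tie; split => //.
- by move=> e; rewrite /ctau big_ord1; exact: (pos (e, 0%N)).
- by move=> e n; rewrite ctauS ltrDl; exact: (pos (e, n.+1)).
Qed.

End regularity.

(** * Quiet edges *)

Section quiet_edges.
Context {d : measure_display} {T : measurableType d} {R : realType}.
Variable P : probability T R.
Notation conf := (@config R idx).
Implicit Types (y : conf) (e v a b : int) (n m : nat).
Variables (X : idx -> {RV P >-> R}) (dX : driving X).
Notation Xi := (joint X).

Lemma measurable_quiet s t e : measurable [set y : conf | quiet (ctau y) s t e].
Proof.
apply: measurable_forall => m.
apply: measurableC.
apply: (measurable_preimage (A := [set x | s < x <= t]) (measurable_ctau e m)).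
by rewrite -set_itvoc; exact: measurable_itv.
Qed.

Definition first_after e t n : set conf :=
  [set y | t < ctau y e n /\ forall m, (m < n)%N -> ctau y e m <= t].

Lemma measurable_first_after e t n : measurable (first_after e t n).
Proof.
apply: measurable_conj; first by apply: measurable_lt; [exact: measurable_cst|exact: measurable_ctau].
apply: measurable_forall => m; apply: measurable_imply.
by apply: measurable_le; [exact: measurable_ctau|exact: measurable_cst].
Qed.

Lemma trivIset_first_after e t : trivIset setT (first_after e t).
Proof.
apply/trivIsetP => i j _ _ ij; apply/seteqP; split => y //= [[h1 h2] [h3 h4]].
move: ij; rewrite neq_ltn => /orP[] hij.
  by have := h4 _ hij; rewrite leNgt h1.
by have := h2 _ hij; rewrite leNgt h3.
Qed.

Lemma first_after_exists tau (t : R) (e : int) : (exists n, t < tau e n) ->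
  exists n, t < tau e n /\ forall m, (m < n)%N -> tau e m <= t.
Proof.
move=> h; case: (ex_minnP h) => n h1 h2; exists n; split => // m mn.
by rewrite leNgt; apply/negP => /h2; rewrite leqNgt mn.
Qed.

Section memoryless.
Variables (H : set conf) (e : int) (t S : R).
Hypotheses (t0 : 0 <= t) (S0 : 0 <= S) (mH : measurable H).
(** Formal meaning of: [H] feels the clock of [e] only up to time [t]. The length of a gap ending
    after [t] may be changed freely as long as it still ends after [t]. *)
Hypothesis Hpast : forall y n x x', H (updated y e n x) -> 0 < x' ->
  t < ctau (updated y e n x) e n -> t < ctau (updated y e n x') e n ->
  H (updated y e n x').

Let late n : set conf := [set y | t + S < ctau y e n].

Let mlate n : measurable (late n).
Proof. by apply: measurable_lt; [exact: measurable_cst|exact: measurable_ctau]. Qed.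

Let mHN n : measurable (H `&` first_after e t n).
Proof. by apply: measurableI => //; exact: measurable_first_after. Qed.

(* Given the past, the residual waiting time of the current gap is exponential. *)
Let memoryless n : P (Xi @^-1` (H `&` first_after e t n `&` late n)) =
  ((expR (- S))%:E * P (Xi @^-1` (H `&` first_after e t n)))%E.
Proof.
have [iX _ gX _] := dX.
rewrite !(resample_gap dX e n) //; last exact: measurableI.
rewrite -ge0_integralZl ?lee_fin ?expR_ge0 //; last exact: measurable_resample.
apply: eq_integral => w _; set y := Xi w.
have [past|npast] := pselect (forall m, (m < n)%N -> ctau y e m <= t); last first.
  have e0 (E : set conf) : [set x | (H `&` first_after e t n `&` E) (updated y e n x)] = set0.
    apply/seteqP; split => x //= [[_ [_ h]] _]; apply: npast => m mn.
    by have := h _ mn; rewrite ctau_updated_lt.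
  have := e0 setT; rewrite setIT => ->.
  by rewrite (e0 (late n)) !preimage_set0 measure0 mule0.
have u0 : 0 <= t - last_before y e n.
  rewrite subr_ge0 /last_before; case: n past => [|n'] past; first by rewrite big_ord0.
  exact: past.
(* [u] is the age at time [t] of the gap that is then running. *)
set u := t - last_before y e n in u0.
have tE x : (t < ctau (updated y e n x) e n) = (u < x).
  by rewrite ctau_updated_eq ltrBlDl.
have tSE x : (t + S < ctau (updated y e n x) e n) = (u + S < x).
  by rewrite ctau_updated_eq /u addrAC ltrBlDl.
have fE x : first_after e t n (updated y e n x) <-> u < x.
  rewrite /first_after /= tE; split=> [[]//|h]; split => // m mn.
  by rewrite ctau_updated_lt // past.
(* By [Hpast], either every gap length above [u] leads into [H] or none does: the two sets of gap
   lengths are half-lines or both empty. *)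
have [[x0 [ux0 Hx0]]|nH] := pselect (exists x0, u < x0 /\ H (updated y e n x0)).
  have Hx x : u < x -> H (updated y e n x).
    by move=> ux; apply: (Hpast Hx0); rewrite ?tE // (le_lt_trans u0 ux).
  have -> : [set x | (H `&` first_after e t n `&` late n) (updated y e n x)] =
      [set x | u + S < x].
    apply/seteqP; split => x /=; rewrite /late /= tSE; first by case.
    move=> h; have ux : u < x by apply: le_lt_trans h; rewrite lerDl.
    by split => //; split; [exact: Hx|apply/fE].
  have -> : [set x | (H `&` first_after e t n) (updated y e n x)] = [set x | u < x].
    apply/seteqP; split => x /=; first by case=> _ /fE.
    by move=> ux; split; [exact: Hx|apply/fE].
  rewrite (exponential_gt (gX e n) (addr_ge0 u0 S0)) (exponential_gt (gX e n) u0).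
  rewrite -EFinM -expRD; congr (expR _)%:E.
  by rewrite opprD addrC.
have e0 (E : set conf) : [set x | (H `&` first_after e t n `&` E) (updated y e n x)] = set0.
  by apply/seteqP; split => x //= [[Hx /fE ux] _]; apply: nH; exists x.
have := e0 setT; rewrite setIT => ->.
by rewrite (e0 (late n)) !preimage_set0 measure0 mule0.
Qed.

(** The events are split by the index [n] of the first event of [e] after [t]; quiet until [t + S]
    then means that event [n] comes after [t + S], and each piece carries the same factor. *)
Lemma quiet_prob :
  P (Xi @^-1` (H `&` [set y | quiet (ctau y) t (t + S) e])) =
  ((expR (- S))%:E * P (Xi @^-1` H))%E.
Proof.
have mQ := measurable_quiet t (t + S) e.
have tri F : trivIset setT (fun n => Xi @^-1` (H `&` first_after e t n `&` F n)).
  apply/trivIsetP => i j _ _ ij; rewrite -preimage_setI.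
  have /trivIsetP /(_ i j I I ij) h : trivIset setT (first_after e t).
    exact: trivIset_first_after.
  apply/seteqP; split => w //= -[[[_ h1] _] [[_ h2] _]].
  by rewrite -[False]/(set0 (Xi w)) -h.
have mP := measurable_joint_preimage X.
have -> : P (Xi @^-1` (H `&` [set y | quiet (ctau y) t (t + S) e])) =
    P (\bigcup_n Xi @^-1` (H `&` first_after e t n `&` late n)).
  apply: measure_ae_eq.
  - by apply: mP; exact: measurableI.
  - by apply: bigcupT_measurable => n; apply: mP; exact: measurableI.
  have := regular_ae dX; apply: filterS => w rw.
  have [_ _ unb _] := rw; split => /=.
    move=> [Hw qw]; have [n [n1 n2]] := first_after_exists (unb e t).
    exists n => //; split; first by split.
    by rewrite /late /= ltNge; apply/negP => n3; apply: (qw n); rewrite n1.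
  move=> [n _ [[Hw [n1 n2]] n3]]; split => // m /andP[m1 m2].
  have nm : (n <= m)%N by rewrite leqNgt; apply/negP => /n2; rewrite leNgt m1.
  move: n3; rewrite /late /= ltNge => /negP; apply; apply: le_trans m2.
  by rewrite (regular_le e rw).
have -> : P (Xi @^-1` H) = P (\bigcup_n Xi @^-1` (H `&` first_after e t n `&` setT)).
  apply: measure_ae_eq; first exact: mP.
    by apply: bigcupT_measurable => n; apply: mP; rewrite setIT.
  have := regular_ae dX; apply: filterS => w [_ _ unb _]; split => /=.
    by move=> Hw; have [n hn] := first_after_exists (unb e t); exists n.
  by move=> [n _ [[]]].
rewrite !measure_bigcup //; last 2 first.
- by move=> n _; apply: mP; rewrite setIT.
- by move=> n _; apply: mP; exact: measurableI.
rewrite -nneseriesZl //; apply: eq_eseriesr => n _.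
by rewrite setIT; exact: memoryless.
Qed.

End memoryless.

End quiet_edges.

(** * Observables of the process as events of the driving randomness *)

Section observables.
Context {R : realType} (mu : R).
Notation conf := (@config R idx).
Implicit Types (y : conf) (e v a b lo hi : int) (n m : nat) (s t : R).
Implicit Types (Phi : (int -> R) -> (int -> R) -> R).

Definition cstate y u : int -> R := replay mu (ccoin y) u (cinit y).

Definition local_on lo hi Phi := forall x x' z z',
  (forall v, lo <= v <= hi -> x v = x' v) -> (forall v, lo <= v <= hi -> z v = z' v) ->
  Phi x z = Phi x' z'.

(** Quantified over all measurable spaces because it is used both on the probability space of the
    process and on [config]. *)
Definition measurable_functional Phi := forall d (T : measurableType d) (p q : T -> int -> R),
  (forall v, measurable_fun setT (fun w => p w v)) ->
  (forall v, measurable_fun setT (fun w => q w v)) ->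
  measurable_fun setT (fun w => Phi (p w) (q w)).

(* The event that [Phi] of the states at times s and t lies in A, read off the
   driving randomness inside a finite window bounded by quiet edges. *)
Definition obs lo hi Phi (A : set R) s t : set conf :=
  [set y | (forall p : int * nat, 0 < cgap y p.1 p.2) /\
    exists q : (int * int) * (seq (int * nat) * seq (int * nat)),
      (q.1.1 < lo /\ hi <= q.1.2) /\
      (word (ctau y) q.1.1 q.1.2 0 s q.2.1 /\
      (word (ctau y) q.1.1 q.1.2 0 t q.2.2 /\
       A (Phi (cstate y q.2.1) (cstate y q.2.2))))].

Lemma measurable_sorted u : measurable [set y : conf | sorted (earlier (ctau y)) u].
Proof.
case: u => [|p u]; first exact: (@measurable_const _ conf true).
elim: u p => [|r u IH] p; first exact: (@measurable_const _ conf true).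
have -> : [set y : conf | sorted (earlier (ctau y)) [:: p, r & u]] =
    [set y : conf | ctau y p.1 p.2 < ctau y r.1 r.2] `&`
    [set y : conf | sorted (earlier (ctau y)) (r :: u)].
  by apply/seteqP; split => y /=; [move=> /andP|move=> [? ?]; apply/andP].
apply: measurableI; last exact: IH.
by apply: measurable_lt; exact: measurable_ctau.
Qed.

Lemma measurable_word a b s t u : measurable [set y : conf | word (ctau y) a b s t u].
Proof.
have -> : [set y : conf | word (ctau y) a b s t u] =
    [set y : conf | sorted (earlier (ctau y)) u /\
      ((forall p : int * nat, a <= p.1 <= b -> s < ctau y p.1 p.2 <= t -> p \in u) /\
       (forall p : int * nat, p \in u -> a < p.1 < b /\ s < ctau y p.1 p.2 <= t))].
  apply/seteqP; split => y [h1 h2]; first by split => //; split => // -[e n]; exact: h2.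
  by case: h2 => h2 h3; split => // e n; exact: (h2 (e, n)).
have mitv (p : int * nat) : measurable [set y : conf | s < ctau y p.1 p.2 <= t].
  apply: (measurable_preimage (A := [set x | s < x <= t]) (measurable_ctau p.1 p.2)).
  by rewrite -set_itvoc; exact: measurable_itv.
apply: measurable_conj; last apply: measurable_conj.
- exact: measurable_sorted.
- apply: measurable_forall => p; apply: measurable_imply.
  exact: measurable_imply_const (mitv p).
- apply: measurable_forall => p; apply: measurable_imply.
  by apply: measurable_conj (mitv p); exact: (@measurable_const _ conf (a < p.1 < b)).
Qed.

Lemma measurable_cstate u v : measurable_fun setT (fun y : conf => cstate y u v).
Proof.
apply: measurable_replay => [e n|k]; first exact: measurable_ccoin.
exact: measurable_cinit.
Qed.

Lemma measurable_obs lo hi Phi A s t : measurable_functional Phi -> measurable A ->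
  measurable (obs lo hi Phi A s t).
Proof.
move=> mPhi mA; apply: measurable_conj.
  apply: measurable_forall => p; apply: measurable_lt; first exact: measurable_cst.
  exact: measurable_cgap.
apply: measurable_exists => -[[a b] [u1 u2]] /=.
apply: measurable_conj; first exact: (@measurable_const _ conf (a < lo /\ hi <= b)).
apply: measurable_conj; first exact: measurable_word.
apply: measurable_conj; first exact: measurable_word.
apply: (measurable_preimage (f := fun y : conf => Phi (cstate y u1) (cstate y u2))) => //.
by apply: mPhi => v; exact: measurable_cstate.
Qed.

Lemma ctau_le y e n m : (forall p : int * nat, 0 < cgap y p.1 p.2) ->
  (n <= m)%N -> ctau y e n <= ctau y e m.
Proof.
move=> pos; elim: m => [|m IH]; first by rewrite leqn0 => /eqP ->.
rewrite leq_eqVlt => /orP[/eqP -> //|/IH h].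
by rewrite ctauS (le_trans h) // lerDl ltW //; exact: (pos (e, m.+1)).
Qed.

Lemma updated_pos y e n x x' : (forall p : int * nat, 0 < cgap (updated y e n x) p.1 p.2) ->
  0 < x' -> forall p : int * nat, 0 < cgap (updated y e n x') p.1 p.2.
Proof.
move=> pos x'0 [e' m]; have := pos (e', m); rewrite /= !cgap_updated.
by case: ifP.
Qed.

Lemma cstate_updated y e n x u : cstate (updated y e n x) u = cstate y u.
Proof. by []. Qed.

(** Events of [e] before the [n]-th do not involve gap [n], and those from the [n]-th on come after
    [r] for both values, because gaps are positive; this is why [obs] includes positivity. Hence
    both clocks show the same events up to [r]. *)
Lemma obs_past lo hi Phi A s t r y e n x x' : s <= r -> t <= r ->
  obs lo hi Phi A s t (updated y e n x) -> 0 < x' ->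
  r < ctau (updated y e n x) e n -> r < ctau (updated y e n x') e n ->
  obs lo hi Phi A s t (updated y e n x').
Proof.
move=> sr tr [pos [[[a b] [u1 u2]] /= [hab [w1 [w2 hA]]]]] x'0 r1 r2.
have pos' := updated_pos pos x'0.
have agree e' m : (ctau (updated y e n x) e' m <= r) || (ctau (updated y e n x') e' m <= r) ->
    ctau (updated y e n x) e' m = ctau (updated y e n x') e' m.
  have [->|ee] := eqVneq e' e; last by rewrite !ctau_updated_neq.
  have [mn|nm] := ltnP m n; first by rewrite !ctau_updated_lt.
  have := lt_le_trans r1 (ctau_le e pos nm); rewrite ltNge => /negPf -> /=.
  by have := lt_le_trans r2 (ctau_le e pos' nm); rewrite ltNge => /negPf ->.
have agree' z : z <= r -> forall e' m,
    (ctau (updated y e n x) e' m <= z) || (ctau (updated y e n x') e' m <= z) ->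
    ctau (updated y e n x) e' m = ctau (updated y e n x') e' m.
  by move=> zr e' m /orP[h|h]; apply: agree; rewrite (le_trans h zr) ?orbT.
split; first exact: pos'.
exists ((a, b), (u1, u2)); split; first exact: hab.
split; first exact: word_agree (agree' _ sr) w1.
split; first exact: word_agree (agree' _ tr) w2.
by rewrite !cstate_updated in hA *.
Qed.

End observables.

(** * The process as a function of its driving family; translation invariance *)

Section model.
Context {d : measure_display} {T : measurableType d} {R : realType}.
Variables (P : probability T R) (mu : R).
Implicit Types (gap coin : int -> nat -> {RV P >-> R}) (eta : R -> int -> {RV P >-> R}).
Implicit Types (e v k lo hi : int) (s t : R) (A : set R).
Notation conf := (@config R idx).

Definition source eta gap coin : idx -> {RV P >-> R} := randomness (eta 0) gap coin.

Lemma model_driving gap coin eta : compass_model mu gap coin eta ->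
  driving (source eta gap coin).
Proof. by case. Qed.

Lemma regular_quiet tau t e : regular tau -> t < tau e 0%N -> quiet tau 0 t e.
Proof.
move=> rt te m /andP[_ mt].
have := lt_le_trans te (_ : tau e 0%N <= tau e m).
by rewrite (regular_le e rt) ltNge mt => /(_ isT).
Qed.

Lemma window_ae (X : idx -> {RV P >-> R}) t lo hi : driving X -> 0 <= t ->
  {ae P, forall w, exists a b, [/\ a < lo, hi <= b,
     quiet (ctau (joint X w)) 0 t a & quiet (ctau (joint X w)) 0 t b]}.
Proof.
move=> dX t0; have [_ _ gX _] := dX.
have h1 : {ae P, forall w, exists i : nat, t < X (gap_ix (lo - 1 - i%:Z) 0) w}.
  by apply: (gaps_gt_ae dX) => // i j [] /=; lia.
have h2 : {ae P, forall w, exists i : nat, t < X (gap_ix (hi + i%:Z) 0) w}.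
  by apply: (gaps_gt_ae dX) => // i j [] /=; lia.
apply: filterS3 (regular_ae dX) h1 h2 => w rw [i hi1] [j hj].
exists (lo - 1 - i%:Z), (hi + j%:Z); split; [lia|lia| |];
  by apply: regular_quiet => //; rewrite /ctau big_ord1.
Qed.

Lemma path_ae gap coin eta : compass_model mu gap coin eta ->
  {ae P, forall w, compass_path mu (ctau (joint (source eta gap coin) w))
     (ccoin (joint (source eta gap coin) w)) (fun t v => eta t v w)}.
Proof. by case. Qed.

Lemma quiet_sub tau e (s s' t t' : R) : s <= s' -> t' <= t -> quiet tau s t e -> quiet tau s' t' e.
Proof.
move=> ss tt q m /andP[h1 h2]; apply: (q m).
by rewrite (le_lt_trans ss h1) (le_trans h2 tt).
Qed.

(** In any window bounded by quiet edges the replayed state is the true one, whichever window and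
    words witness [obs]; conversely almost surely some window exists. *)
Lemma obs_ae gap coin eta lo hi Phi A s t : compass_model mu gap coin eta ->
  lo <= hi -> local_on lo hi Phi -> 0 <= s -> 0 <= t ->
  {ae P, forall w, (joint (source eta gap coin) @^-1` obs mu lo hi Phi A s t) w <->
     A (Phi (fun v => eta s v w) (fun v => eta t v w))}.
Proof.
move=> heta lohi lPhi s0 t0; have dX := model_driving heta.
(* One window, quiet up to the later of the two times, serves both. *)
have st0 : 0 <= Num.max s t by rewrite le_max s0.
apply: filterS3 (filterI (regular_ae dX) (gaps_pos_ae dX)) (window_ae lo hi dX st0)
  (path_ae heta) => w [rw pos] [a [b [alo hib qa qb]]] pw.
have state r a' b' u v : 0 <= r -> a' < lo -> hi <= b' ->
    word (ctau (joint (source eta gap coin) w)) a' b' 0 r u -> lo <= v <= hi ->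
    cstate mu (joint (source eta gap coin) w) u v = eta r v w.
  move=> r0 alo' hib' hu /andP[v1 v2]; symmetry.
  apply: (path_replay pw (lexx 0) r0 hu).
  by rewrite (lt_le_trans alo' v1) (le_trans v2 hib').
split=> [[_ [[[a' b'] [u1 u2]] /= [[alo' hib'] [w1 [w2]]]]]|hA].
  rewrite (lPhi _ (fun v => eta s v w) _ (fun v => eta t v w)) // => v hv.
    exact: state s0 alo' hib' w1 hv.
  exact: state t0 alo' hib' w2 hv.
split; first exact: pos.
have ab : a < b by rewrite (lt_le_trans alo) // (le_trans lohi).
have sm : s <= Num.max s t by rewrite le_max lexx.
have tm : t <= Num.max s t by rewrite le_max lexx orbT.
have [u1 hu1] := word_exists rw ab (quiet_sub (lexx 0) sm qa) (quiet_sub (lexx 0) sm qb).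
have [u2 hu2] := word_exists rw ab (quiet_sub (lexx 0) tm qa) (quiet_sub (lexx 0) tm qb).
exists ((a, b), (u1, u2)); split; first by split.
split; first exact: hu1.
split; first exact: hu2.
rewrite /= (lPhi _ (fun v => eta s v w) _ (fun v => eta t v w)) // => v hv.
  exact: state s0 alo hib hu1 hv.
exact: state t0 alo hib hu2 hv.
Qed.

Lemma prob_obs gap coin eta lo hi Phi A s t : compass_model mu gap coin eta ->
  lo <= hi -> local_on lo hi Phi -> measurable_functional Phi -> measurable A ->
  0 <= s -> 0 <= t ->
  P [set w | A (Phi (fun v => eta s v w) (fun v => eta t v w))] =
  P (joint (source eta gap coin) @^-1` obs mu lo hi Phi A s t).
Proof.
move=> heta lohi lPhi mPhi mA s0 t0; apply: measure_ae_eq.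
- apply: (measurable_preimage (f := fun w => Phi (fun v => eta s v w) (fun v => eta t v w))) => //.
  by apply: mPhi => v; exact: measurable_funPT.
- by apply: measurable_joint_preimage; exact: measurable_obs.
by apply: filterS (obs_ae A heta lohi lPhi s0 t0) => w [? ?]; split.
Qed.

Let shift_ix k (i : idx) : idx := match i with
  | inl (inl v) => inl (inl (v + k))
  | inl (inr (v, n)) => inl (inr (v + k, n))
  | inr (v, n) => inr (v + k, n) end.

Let shift_ixK k : cancel (shift_ix k) (shift_ix (- k)).
Proof. by move=> [[v|[v n]]|[v n]] /=; rewrite addrK. Qed.

Lemma compass_model_shift k gap coin eta : compass_model mu gap coin eta ->
  compass_model mu (fun v => gap (v + k)) (fun v => coin (v + k))
    (fun t v => eta t (v + k)).
Proof.
move=> [hcirc hinit hgap hcoin hindep hdyn]; split => //.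
- by move=> t v w t0; exact: hcirc.
- move=> J A uJ mA.
  have rE i : randomness (fun v => eta 0 (v + k)) (fun v => gap (v + k)) (fun v => coin (v + k)) i
      = randomness (eta 0) gap coin (shift_ix k i) by case: i => [[v|[v n]]|[v n]].
  have := hindep (map (shift_ix k) J) (fun i => A (shift_ix (- k) i)).
  rewrite map_inj_uniq; last exact: can_inj (shift_ixK k).
  move=> /(_ uJ (fun i => mA _)); rewrite !big_map.
  under eq_bigr do rewrite shift_ixK -rE.
  by move=> ->; apply: eq_bigr => i _; rewrite shift_ixK rE.
- apply: filterS hdyn => w [h1 h2]; split.
    move=> s t v s0 st q1 q2; apply: h1 => //.
    by rewrite (_ : v + k - 1 = v - 1 + k); [exact: q1|ring].
  move=> v n; have := h2 (v + k) n.
  by rewrite (_ : v + k + 1 = v + 1 + k) //; ring.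
Qed.

(** The translated process is again a compass model, and both sides are probabilities of the same
    set [obs] under driving families of equal law. *)
Lemma law_shift gap coin eta k lo hi Phi A s t : compass_model mu gap coin eta ->
  lo <= hi -> local_on lo hi Phi -> measurable_functional Phi -> measurable A ->
  0 <= s -> 0 <= t ->
  P [set w | A (Phi (fun v => eta s (v + k) w) (fun v => eta t (v + k) w))] =
  P [set w | A (Phi (fun v => eta s v w) (fun v => eta t v w))].
Proof.
move=> heta lohi lPhi mPhi mA s0 t0; have heta' := compass_model_shift k heta.
rewrite (prob_obs heta lohi lPhi) // (prob_obs heta' lohi lPhi) //.
apply: driving_law_unique; [exact: model_driving heta'|exact: model_driving heta|].
exact: measurable_obs.
Qed.

End model.

(** * Antipodal symmetry and absence of strong consensus *)

Section flip_deterministic.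
Context {R : realType} (mu : R).
Implicit Types (x : int -> R) (k e v : int).
Notation conf := (@config R idx).

Definition flip_below k x v : R := if v <= k then antipode (x v) else x v.

Lemma antipodeE (z : R) : exists i : int, antipode z = z + 1 + 2 * i%:~R.
Proof. exact: wrapE. Qed.

Lemma wrap_eq (z z' : R) (i : int) : z = z' + 2 * i%:~R -> wrap z = wrap z'.
Proof. by move=> ->; exact: wrapD2. Qed.

(** Edge [k] joins [k] and [k + 1]; every other edge has both endpoints on the same side, and a
    simultaneous rotation of both by a half turn commutes with the update. *)
Lemma ring_flip_below c k e x : e != k ->
  ring mu c e (flip_below k x) = flip_below k (ring mu c e x).
Proof.
move=> ek; apply/funext => v; rewrite /ring /flip_below.
have [i1 h1] := antipodeE (x e); have [i2 h2] := antipodeE (x (e + 1)).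
have hd : displacement c (if e <= k then antipode (x e) else x e)
    (if e + 1 <= k then antipode (x (e + 1)) else x (e + 1)) =
    displacement c (x e) (x (e + 1)).
  rewrite /displacement; have [ek1|ek1] := leP (e + 1) k; last first.
    by rewrite (_ : e <= k = false) //; lia.
  rewrite (_ : e <= k = true); last by lia.
  by rewrite h1 h2 (wrap_eq (z' := x (e + 1) - x e) (i := i2 - i1)) // intrB; ring.
rewrite hd; set s := displacement _ _ _.
case: eqVneq => [->|ve].
  case: ifP => // _; rewrite h1 /antipode; have [i3 ->] := wrapE (x e + mu * s).
  by apply: (wrap_eq (i := i1 - i3)); rewrite intrB; ring.
case: eqVneq => [->|//].
case: ifP => // _; rewrite h2 /antipode; have [i3 ->] := wrapE (x (e + 1) - mu * s).
by apply: (wrap_eq (i := i2 - i3)); rewrite intrB; ring.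
Qed.

Lemma replay_flip_below c k u x : (forall p : int * nat, p \in u -> p.1 != k) ->
  replay mu c u (flip_below k x) = flip_below k (replay mu c u x).
Proof.
elim: u x => [|p u IH] x hu //=; rewrite ring_flip_below ?IH // => [q qu|].
  by apply: hu; rewrite inE qu orbT.
by apply: hu; rewrite inE eqxx.
Qed.

(** A point and its antipode cut the circle into two half circles of length 1, and [z'] lies on one
    of them. *)
Lemma arc_sub_antipode (z z' : R) : arc (z' - antipode z) = 1 - arc (z' - z).
Proof.
have [i ->] := antipodeE z; have [j hj] := wrapE (z' - z).
have /andP[w1 w2] := wrap_bounds (z' - z); set w := wrap _ in hj w1 w2.
have -> : arc (z' - z) = `|w| by [].
rewrite (_ : z' - _ = w - 1 + 2 * (- i - j)%:~R); last by rewrite hj intrB intrN; ring.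
rewrite arcD2; have [w0|w0] := leP w 0.
  rewrite (_ : w - 1 = w + 1 + 2 * (-1)%:~R); last by rewrite intrN; ring.
  rewrite arcD2 /arc wrap_id; last by rewrite in_itv /=; lra.
  by rewrite (ler0_norm w0) ger0_norm; lra.
rewrite /arc wrap_id; last by rewrite in_itv /=; lra.
by rewrite (gtr0_norm w0) ler0_norm; lra.
Qed.

Definition flip_config k (y : conf) : conf := fun i =>
  if i is inl (inl v) then flip_below k (cinit y) v else y i.

End flip_deterministic.

Section flip_law.
Context {d : measure_display} {T : measurableType d} {R : realType}.
Variables (P : probability T R).
Implicit Types (X : {RV P >-> R}) (Y : idx -> {RV P >-> R}).

Definition antipode_RV X : T -> R := fun w => antipode (X w).

Let measurable_antipode_RV X : measurable_fun setT (antipode_RV X).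
Proof. by apply: (measurableT_comp measurable_antipode); exact: measurable_funPT. Qed.

HB.instance Definition _ X :=
  isMeasurableFun.Build _ _ _ _ (antipode_RV X) (measurable_antipode_RV X).

Definition flip_source k Y : idx -> {RV P >-> R} := fun i =>
  if i is inl (inl v) then if v <= k then (antipode_RV (Y i) : {RV P >-> R}) else Y i
  else Y i.

Lemma joint_flip k Y w : joint (flip_source k Y) w = flip_config k (joint Y w).
Proof.
apply/funext => -[[v|[v n]]|[v n]] //.
by rewrite /joint /flip_source /flip_config /flip_below; case: ifP.
Qed.

(** Each variable is transformed on its own, so independence persists with preimages as test sets;
    the uniform law is invariant under the antipodal map. *)
Lemma flip_driving k Y : driving Y -> driving (flip_source k Y).
Proof.
move=> [iY uY gY cY]; split => // [J A uJ mA|v].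
  pose A' i : set R := if i is inl (inl v) then
     if v <= k then [set x | A i (antipode x)] else A i else A i.
  have AE i : flip_source k Y i @^-1` A i = Y i @^-1` A' i.
    by case: i => [[v|[v n]]|[v n]] //; rewrite /flip_source /A'; case: ifP.
  under eq_bigr do rewrite AE; under [RHS]eq_bigr do rewrite AE.
  apply: iY => // -[[v|[v n]]|[v n]] //; rewrite /A'; case: (v <= k) => //.
  exact: measurable_preimage measurable_antipode (mA _).
move=> A mA; rewrite /flip_source; case: ifP => _; last exact: uY.
rewrite -uniform_antipode //; apply: (uY v).
exact: measurable_preimage measurable_antipode mA.
Qed.

Lemma cstate_flip mu k (y : @config R idx) u : (forall p : int * nat, p \in u -> p.1 != k) ->
  cstate mu (flip_config k y) u = flip_below k (cstate mu y u).
Proof. by move=> hu; rewrite /cstate -replay_flip_below. Qed.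

Lemma measurable_arc_sub d' (T' : measurableType d') (p q : T' -> int -> R) v v' :
  (forall v, measurable_fun setT (fun w => p w v)) ->
  (forall v, measurable_fun setT (fun w => q w v)) ->
  measurable_fun setT (fun w => arc (q w v' - p w v)).
Proof. by move=> mp mq; apply: measurable_arc; exact: measurable_funB. Qed.

End flip_law.

Section quiet_windows.
Context {d : measure_display} {T : measurableType d} {R : realType}.
Variables (P : probability T R) (X : idx -> {RV P >-> R}).
Hypothesis dX : driving X.
Notation conf := (@config R idx).

Definition quiet_among (f : nat -> int) (t : R) K : set conf :=
  [set y | exists2 j, (j < K)%N & quiet (ctau y) 0 t (f j)].

Lemma measurable_quiet_among f t K : measurable (quiet_among f t K).
Proof.
have -> : quiet_among f t K = [set y : conf | exists j, (j < K)%N /\ quiet (ctau y) 0 t (f j)].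
  by apply/seteqP; split => y [j]; [exists j|move=> []; exists j].
apply: measurable_exists => j; apply: measurable_conj; last exact: measurable_quiet.
exact: (@measurable_const _ conf (j < K)%N).
Qed.

(** An edge that rings by time [t] has a first gap at most [t], and the first gaps of distinct edges
    are independent. *)
Lemma no_quiet_among f t K : injective f -> 0 <= t ->
  (P (joint X @^-1` ~` quiet_among f t K) <= ((1 - expR (- t)) ^+ K)%:E)%E.
Proof.
move=> fI t0; have [_ _ gX _] := dX.
have mN := measurableC (measurable_quiet_among f t K).
pose g j := gap_ix (f j) 0.
have gI : injective g by move=> i j [] /fI.
rewrite -(gaps_le dX K gI (fun i => gX _ _) t0).
pose E := [set y : conf | forall i, (i < K)%N -> (y : idx -> R) (g i) <= t].
have mE : measurable E.
  apply: measurable_forall => i; apply: measurable_imply.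
  by apply: measurable_le; [exact: measurable_coord|exact: measurable_cst].
have mP := measurable_joint_preimage X.
have -> : P (joint X @^-1` ~` quiet_among f t K) =
    P (joint X @^-1` (~` quiet_among f t K `&` E)).
  apply: measure_ae_eq; [exact: mP|by apply: mP; exact: measurableI|].
  apply: filterS (regular_ae dX) => w rw; split => [nq|[]//].
  split => // i iK; rewrite leNgt; apply/negP => ti; apply: nq; exists i => //.
  by apply: regular_quiet => //; rewrite /ctau big_ord1.
apply: le_measure; rewrite ?inE; [by apply: mP; exact: measurableI|exact: mP|].
by move=> w [].
Qed.

End quiet_windows.

Section antipodal_symmetry.
Context {d : measure_display} {T : measurableType d} {R : realType}.
Variables (P : probability T R) (mu : R) (gap coin : int -> nat -> {RV P >-> R})
  (eta : R -> int -> {RV P >-> R}).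
Hypothesis heta : compass_model mu gap coin eta.
Variables (N : nat) (t : R).
Hypothesis t0 : 0 <= t.
Notation conf := (@config R idx).
Notation X := (source eta gap coin).
Implicit Types (y : conf) (k : nat).

Let dX := model_driving heta.
Let Phi (x z : int -> R) : R := arc (z N%:Z - x 0).
Let far (A : set R) : set conf := obs mu 0 N%:Z Phi A t t.

Let lPhi : local_on 0 N%:Z Phi.
Proof. by move=> x x' z z' h1 h2; rewrite /Phi h1 ?h2 //; lia. Qed.

Let mPhi : measurable_functional Phi.
Proof. by move=> d' T' p q mp mq; exact: measurable_arc_sub. Qed.

Let quiet_before k : set conf := quiet_among (fun j => j%:Z) t k.

Let mquiet_before k : measurable (quiet_before k). Proof. exact: measurable_quiet_among. Qed.

(** Taking the first quiet edge picks a single place to flip at, by a rule that depends on the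
    clocks alone and is therefore unaffected by the flip. *)
Let first_quiet k : set conf := quiet_before k.+1 `\` quiet_before k.

Let flip_far k y A : (k < N)%N -> first_quiet k y ->
  far A (flip_config k%:Z y) <-> far [set r | A (1 - r)] y.
Proof.
move=> kN [[j jk qj] nq].
have {}qk : quiet (ctau y) 0 t k%:Z.
  move: jk; rewrite ltnS leq_eqVlt => /orP[/eqP <- //|jk].
  by case: nq; exists j.
have off a b u : word (ctau y) a b 0 t u -> forall p : int * nat, p \in u -> p.1 != k%:Z.
  by move=> [_ _ hu] p /hu [_ pt]; apply/eqP => pk; apply: (qk p.2); rewrite -pk.
have PhiE a b a' b' u1 u2 : word (ctau y) a b 0 t u1 -> word (ctau y) a' b' 0 t u2 ->
    Phi (cstate mu (flip_config k%:Z y) u1) (cstate mu (flip_config k%:Z y) u2) =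
    1 - Phi (cstate mu y u1) (cstate mu y u2).
  move=> w1 w2; rewrite (cstate_flip _ _ (off _ _ _ w1)) (cstate_flip _ _ (off _ _ _ w2)).
  rewrite /Phi /flip_below (_ : 0 <= k%:Z = true) // (_ : N%:Z <= k%:Z = false); last by lia.
  exact: arc_sub_antipode.
split=> -[pos [[[a b] [u1 u2]] [ab [w1 [w2 hP]]]]].
  split; first exact: pos.
  exists ((a, b), (u1, u2)); split; first exact: ab.
  split; first exact: w1.
  split; first exact: w2.
  by rewrite /= -(PhiE _ _ _ _ _ _ w1 w2).
split; first exact: pos.
exists ((a, b), (u1, u2)); split; first exact: ab.
split; first exact: w1.
split; first exact: w2.
by rewrite /= (PhiE _ _ _ _ _ _ w1 w2).
Qed.

(** Where [k] is the first quiet edge, the distance [r] may be exchanged with [1 - r], and one of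
    the two is at least [2^-1]. So at least half of that event has a large distance, and the pieces
    add up over [k < N]. *)
Lemma antipodal_far :
  (P (joint X @^-1` quiet_among (fun j => j%:Z) t N) <=
   P [set w | (2^-1 <= arc (eta t N%:Z w - eta t 0 w))%R] +
   P [set w | (2^-1 <= arc (eta t N%:Z w - eta t 0 w))%R])%E.
Proof.
pose A := [set r : R | 2^-1 <= r].
have mA : measurable A by rewrite /A -set_itvcy; exact: measurable_itv.
pose A' := [set r : R | r <= 2^-1].
have mA' : measurable A' by rewrite /A' -set_itvNyc; exact: measurable_itv.
have mfar B : measurable B -> measurable (far B) by move=> mB; exact: measurable_obs.
have mP := measurable_joint_preimage X.
rewrite [X in (_ <= X + X)%E](_ : _ = P (joint X @^-1` far A)); last first.
  by rewrite -(prob_obs heta _ lPhi mPhi).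
suff h k : (k <= N)%N -> (P (joint X @^-1` quiet_before k) <=
    P (joint X @^-1` (quiet_before k `&` far A)) +
    P (joint X @^-1` (quiet_before k `&` far A)))%E.
  apply: le_trans (h N (leqnn N)) _; apply: leeD; apply: le_measure; rewrite ?inE;
    by [apply: mP; exact: mfar|apply: mP; apply: measurableI => //; exact: mfar|move=> w []].
elim: k => [|k IH] kN.
  rewrite (_ : quiet_before 0 = set0) ?preimage_set0 ?measure0 ?adde_ge0 //.
  by apply/seteqP; split => y // [j].
have mfirst : measurable (first_quiet k) by exact: measurableD.
have split_quiet (B : set conf) : measurable B ->
    P (joint X @^-1` (quiet_before k.+1 `&` B)) =
    (P (joint X @^-1` (quiet_before k `&` B)) + P (joint X @^-1` (first_quiet k `&` B)))%E.
  move=> mB; rewrite -measureU; [|by apply: mP; exact: measurableI..|].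
    rewrite -preimage_setU -setIUl /first_quiet setDUK // => y [j jk qj].
    by exists j => //; exact: ltnW.
  by rewrite -preimage_setI; apply/seteqP; split => w //= [[? _] [[_ ?] _]].
have same : P (joint X @^-1` (first_quiet k `&` far A)) =
    P (joint X @^-1` (first_quiet k `&` far A')).
  have dF := flip_driving k%:Z dX.
  rewrite (driving_law_unique dX dF); last by apply: measurableI => //; exact: mfar.
  have A'E : A' = [set r | A (1 - r)].
    by apply/seteqP; split => r; rewrite /A /A' /=; lra.
  congr (P _); rewrite A'E; apply/seteqP; split => w; rewrite /preimage /= joint_flip.
    move=> [fq fw]; have fq' : first_quiet k (joint X w) := fq.
    by split => //; apply/(flip_far _ kN fq').
  by move=> [fq fw]; split; [exact: fq|apply/(flip_far _ kN fq)].
have mF B : measurable B -> measurable (joint X @^-1` (first_quiet k `&` far B)).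
  by move=> mB; apply: mP; apply: measurableI => //; exact: mfar.
have half : (P (joint X @^-1` first_quiet k) <=
   P (joint X @^-1` (first_quiet k `&` far A)) + P (joint X @^-1` (first_quiet k `&` far A)))%E.
  have -> : P (joint X @^-1` first_quiet k) =
      P (joint X @^-1` (first_quiet k `&` far A) `|` joint X @^-1` (first_quiet k `&` far A')).
    apply: measure_ae_eq; [exact: mP|by apply: measurableU; exact: mF|].
    have N0 : 0 <= N%:Z by [].
    apply: filterS2 (obs_ae A heta N0 lPhi t0 t0) (obs_ae A' heta N0 lPhi t0 t0).
    move=> w hA hA'; split; last by move=> [[]|[]].
    move=> fw; have [h|h] := leP 2^-1 (Phi (fun v => eta t v w) (fun v => eta t v w)).
      by left; split => //; apply/hA.
    by right; split => //; apply/hA'; exact: ltW.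
  rewrite {2}same; apply: measureU2; exact: mF.
have e1 := split_quiet setT measurableT; rewrite !setIT in e1.
rewrite e1 (split_quiet _ (mfar A mA)); apply: le_trans (leeD (IH (ltnW kN)) half) _.
by rewrite addeACA.
Qed.

End antipodal_symmetry.

Section no_strong_consensus.
Context {d : measure_display} {T : measurableType d} {R : realType}.
Variables (P : probability T R) (mu : R) (gap coin : int -> nat -> {RV P >-> R})
  (eta : R -> int -> {RV P >-> R}).
Hypothesis heta : compass_model mu gap coin eta.

Let measurable_dist (A B : {RV P >-> R}) (e : R) : measurable [set w | e < arc (A w - B w)].
Proof.
apply: measurable_lt; first exact: measurable_cst.
by apply: measurable_arc; apply: measurable_funB; exact: measurable_funPT.
Qed.

Let dist_trans (A B C : {RV P >-> R}) (e e' : R) :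
  (P [set w | (e + e' < arc (A w - B w))%R] <=
   P [set w | (e < arc (A w - C w))%R] + P [set w | (e' < arc (B w - C w))%R])%E.
Proof.
apply: le_trans (measureU2 _ (measurable_dist _ _ _) (measurable_dist _ _ _)).
apply: le_measure; rewrite ?inE; [exact: measurable_dist|by apply: measurableU; exact: measurable_dist|].
move=> w /= h; case: (ltP e (arc (A w - C w))) => h1; [by left|right].
have := arcD (A w - C w) (- (B w - C w)); rewrite arcN.
by rewrite (_ : _ + _ = A w - B w); [lra|ring].
Qed.

(** This comparison of one vertex at two times is the reason why observables carry two times. *)
Lemma same_vertex_law (s t e : R) (v : int) : 0 <= s -> 0 <= t ->
  P [set w | e < arc (eta s v w - eta t v w)] = P [set w | e < arc (eta s 0 w - eta t 0 w)].
Proof.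
move=> s0 t0.
have := @law_shift _ _ _ P mu gap coin eta v 0 0 (fun x z => arc (x 0 - z 0))
   [set r | e < r] s t heta (lexx _).
rewrite add0r; apply => //.
- by move=> x x' z z' h1 h2; rewrite h1 ?h2.
- by move=> d' T' p q mp mq; apply: measurable_arc; exact: measurable_funB.
- by rewrite -set_itvoy; exact: measurable_itv.
Qed.

Lemma no_strong_consensus :
  ~ (exists L : {RV P >-> R},
       (forall w, L w \in `]-1, 1]) /\
       (forall v : int,
          cvg_to0_in_probability P (fun t w => circle_dist (eta t v w) (L w)))).
Proof.
move=> [L [hL hcvg]].
have hcirc : forall t v w, 0 <= t -> eta t v w \in `]-1, 1] by case: heta.
(* Four comparisons are chained below: four errors [16^-1] stay below [2^-1], and four probabilities
   [32^-1] add up to [8^-1], which [antipodal_far] doubles to [4^-1], too small against a quiet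
   event of probability above [2^-1]. *)
have conv v : exists M : R, forall t, M < t -> 0 <= t ->
    (P [set w | (16^-1 < arc (eta t v w - L w))%R] < (32^-1)%:E)%E.
  have e0 : 0 < 16^-1 :> R by rewrite invr_gt0.
  have := hcvg v _ e0.
  have : nbhs (0%E : \bar R) [set x | (x < (32^-1)%:E)%E].
    by apply: open_ereal_lt'; rewrite lte_fin invr_gt0.
  move=> h /(_ _ h) [M [_ hM]]; exists M => t Mt t0.
  have := hM t Mt; rewrite /=; congr (P _ < _)%E; apply/seteqP; split => w /=.
    by rewrite ger0_norm circle_distE ?arc_ge0 // ?hcirc // -arcN opprB.
  by rewrite ger0_norm circle_distE ?arc_ge0 // ?hcirc // -arcN opprB.
have [M0 hM0] := conv 0.
pose t := Num.max (M0 + 1) 0.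
have t0 : 0 <= t by rewrite le_max lexx orbT.
have tM : M0 < t by rewrite lt_max ltrDl ltr01.
have [N hN] : exists N, (1 - expR (- t)) ^+ N < 2^-1.
  have q1 : `|1 - expR (- t)| < 1.
    rewrite ger0_norm ?gtrBl ?expR_gt0 // subr_ge0 -expR0 ler_expR oppr_le0 //.
  have := cvg_expr q1 => /cvgr0_norm_lt /(_ 2^-1)[]; first by rewrite invr_gt0.
  by move=> N _ /(_ N (leqnn N)) /= hN; exists N; exact: le_lt_trans (ler_norm _) hN.
(* [N] depends on [t], so vertex [N] need not be close to [L] at time [t]. It is so at a later time
   [s], and the law of the change between [t] and [s] at [N] is the one at 0, where both times are
   late enough. *)
have [M1 hM1] := conv N%:Z.
pose s := Num.max (M1 + 1) t.
have s0 : 0 <= s by rewrite le_max t0 orbT.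
have sM : M0 < s by rewrite lt_max tM orbT.
have sM1 : M1 < s by rewrite lt_max ltrDl ltr01.
have b1 := hM0 t tM t0; have b2 := hM0 s sM s0; have b3 := hM1 s sM1 s0.
set p1 := P _ in b1; set p2 := P _ in b2; set p3 := P _ in b3.
have c1 := dist_trans (eta t 0) (eta s 0) L 16^-1 16^-1.
have c2 := dist_trans (eta t N%:Z) L (eta s N%:Z) (16^-1 + 16^-1) 16^-1.
have c3 := dist_trans (eta t N%:Z) (eta t 0) L (16^-1 + 16^-1 + 16^-1) 16^-1.
have half : (P [set w | (2^-1 <= arc (eta t N%:Z w - eta t 0 w))%R] <= (8^-1)%:E)%E.
  have le_half : (P [set w | (2^-1 <= arc (eta t N%:Z w - eta t 0 w))%R] <=
     P [set w | (16^-1 + 16^-1 + 16^-1 + 16^-1 < arc (eta t N%:Z w - eta t 0 w))%R])%E.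
    apply: le_measure; rewrite ?inE; [|exact: measurable_dist|by move=> w /=; lra].
    apply: measurable_le; first exact: measurable_cst.
    by apply: measurable_arc; apply: measurable_funB; exact: measurable_funPT.
  apply: (le_trans le_half); apply: (le_trans c3).
  rewrite (same_vertex_law _ _ t0 s0) in c2.
  have p3E : P [set w | 16^-1 < arc (L w - eta s N%:Z w)] = p3.
    by congr (P _); apply/seteqP; split => w /=; rewrite -arcN opprB.
  rewrite p3E in c2.
  have -> : (8^-1 : R)%:E = ((32^-1)%:E + (32^-1)%:E + (32^-1)%:E + (32^-1)%:E)%E.
    by rewrite -!EFinD; congr _%:E; field.
  apply: leeD; last exact: ltW b1.
  apply: (le_trans c2); apply: leeD; last exact: ltW b3.
  by apply: (le_trans c1); apply: leeD; exact: ltW.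
have mQ := measurable_joint_preimage (source eta gap coin)
  (measurable_quiet_among (R := R) (fun j => j%:Z) t N).
have far := antipodal_far heta N t0.
have nq := no_quiet_among (model_driving heta) (f := fun j => j%:Z) N (fun i j => _) t0.
have {}nq : (P (~` (joint (source eta gap coin) @^-1` quiet_among (fun j : nat => j%:Z) t N)) <=
    ((1 - expR (- t)) ^+ N)%:E)%E.
  by apply: nq => i j [].
rewrite probability_setC // in nq.
have q14 : (P (joint (source eta gap coin) @^-1` quiet_among (fun j : nat => j%:Z) t N) <=
    (4^-1)%:E)%E.
  apply: (le_trans far); rewrite (_ : (4^-1 : R) = 8^-1 + 8^-1); last by field.
  by rewrite EFinD; apply: leeD.
have : (1 - (4^-1)%:E <= ((1 - expR (- t)) ^+ N)%:E)%E.
  by apply: le_trans nq; apply: leeB.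
by rewrite -EFinB lee_fin; lra.
Qed.

End no_strong_consensus.

(** * Loss of gap mass *)

Section pathwise_drop.
Context {R : realType} (mu : R).
Hypotheses (mu_gt0 : 0 < mu) (mu_le : mu <= 2^-1).
Variables (tau c : int -> nat -> R) (x : R -> int -> R).
Hypotheses (rtau : regular tau) (hc : forall e n, c e n = 1 \/ c e n = -1)
  (px : compass_path mu tau c x).
Implicit Types (a b e v k : int) (s t : R).

Lemma gapd_word a b s t u k : 0 <= s -> s <= t -> word tau a b s t u -> a < k < b ->
  gapd (x t) k = gapd (replay mu c u (x s)) k.
Proof.
move=> s0 st hu kab; have e v : a < v <= b -> x t v = replay mu c u (x s) v.
  exact: path_replay px s0 st hu v.
by rewrite /gapd !e //; lia.
Qed.

Lemma gapd_quiet_window a b s t : 0 <= s -> s <= t -> a < b ->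
  quiet tau s t a -> quiet tau s t b ->
  exists u, word tau a b s t u /\
    forall k, a < k < b -> gapd (x t) k = gapd (replay mu c u (x s)) k.
Proof.
move=> s0 st ab qa qb; have [u hu] := word_exists rtau ab qa qb.
by exists u; split => // k; exact: gapd_word s0 st hu.
Qed.

Lemma word_not_quiet a b s t u e : word tau a b s t u -> a <= e <= b ->
  ~ quiet tau s t e -> e \in map fst u.
Proof.
move=> [_ hall _] he /existsNP[m /contrapT hm].
by apply/mapP; exists (e, m) => //; exact: hall.
Qed.

Lemma word_quiet a b s t u (p : int * nat) e : word tau a b s t u -> quiet tau s t e ->
  p \in u -> p.1 != e.
Proof.
by move=> [_ _ hin] qe /hin[_ pt]; apply/eqP => pe; apply: (qe p.2); rewrite -pe.
Qed.

Variables (t S : R) (r n : nat).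
Hypotheses (t0 : 0 <= t) (S0 : 0 <= S) (r0 : (0 < r)%N)
  (hr : (n ^ 3)%:R <= 2 * mu * r%:R).

Let h := r%:R * S.

(* The guard edges of the block are [c0] and [c0 + n + 1]; the n core edges are
   in between. *)
Definition dropping c0 := [/\ 4 <= \sum_(k <- rng c0 n.+2) gapd (x t) k,
  quiet tau t (t + r%:R * S) c0, quiet tau t (t + r%:R * S) (c0 + n.+1%:Z) &
  forall k i, k \in rng (c0 + 1) n -> (i < r)%N ->
    ~ quiet tau (t + i%:R * S) (t + i.+1%:R * S) k].

(** By [hr] the [r] slots bring the core mass down to at most 1, and the two guards hold at most 1
    each. *)
Lemma dropping_mass a b c0 : a < c0 -> c0 + n.+1%:Z < b ->
  quiet tau t (t + h) a -> quiet tau t (t + h) b -> dropping c0 ->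
  \sum_(k <- rng c0 n.+2) gapd (x (t + h)) k <= 3.
Proof.
move=> ac cb qa qb [_ q1 q2 nq].
have ab : a < b by lia.
have le_iS i : t <= t + i%:R * S by rewrite lerDl mulr_ge0.
have iS_le i : (i <= r)%N -> t + i%:R * S <= t + h.
  by move=> ir; rewrite lerD2l ler_wpM2r // ler_nat.
have slot i : (i < r)%N -> exists u, [/\ coins_ok c u, off_guards (c0 + 1) n u,
     forall k, k \in rng (c0 + 1) n -> k \in map fst u &
     forall k, k \in rng (c0 + 1) n ->
       gapd (x (t + i.+1%:R * S)) k = gapd (replay mu c u (x (t + i%:R * S))) k].
  move=> ir; have sub e : quiet tau t (t + h) e ->
      quiet tau (t + i%:R * S) (t + i.+1%:R * S) e.
    exact: quiet_sub (le_iS i) (iS_le _ ir).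
  have iS0 : 0 <= t + i%:R * S by rewrite (le_trans t0).
  have iSS : t + i%:R * S <= t + i.+1%:R * S.
    by rewrite lerD2l ler_wpM2r // ler_nat.
  have [u [hu hg]] := gapd_quiet_window iS0 iSS ab (sub _ qa) (sub _ qb).
  exists u; split => //.
  - move=> p pu; split; first by rewrite addrK; exact: word_quiet hu (sub _ q1) pu.
    rewrite (_ : c0 + 1 + n%:Z = c0 + n.+1%:Z); last by lia.
    exact: word_quiet hu (sub _ q2) pu.
  - move=> k hk; apply: (word_not_quiet hu); last exact: nq.
    by move: hk; rewrite mem_rng; lia.
  - by move=> k; rewrite mem_rng => hk; apply: hg; lia.
have := inner_slots mu_gt0 mu_le (y := fun i => x (t + i%:R * S)) slot.
set I := inner _ _ _ => hI.
have I1 : I <= 1.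
  have : 2 * mu * r%:R * I <= 2 * mu * r%:R * 1 by rewrite mulr1 (le_trans hI).
  by rewrite ler_pM2l // !mulr_gt0 // ltr0n.
have -> : rng c0 n.+2 = c0 :: rng (c0 + 1) n ++ [:: c0 + n.+1%:Z].
  rewrite (_ : n.+2 = 1 + (n + 1))%N; last by lia.
  by rewrite !rng_cat /rng /= !addr0; congr (_ :: _ ++ [:: _]); lia.
rewrite big_cons big_cat /= big_seq1 -/(inner _ _ _) -/I.
have := gapd_le1 (x (t + h)) c0; have := gapd_le1 (x (t + h)) (c0 + n.+1%:Z); lra.
Qed.

Lemma window_drop q K a b (good : pred 'I_q) :
  - K%:Z <= a -> a < 0 -> (q * n.+2)%N%:Z <= b -> b < (q * n.+2)%N%:Z + K%:Z ->
  quiet tau t (t + h) a -> quiet tau t (t + h) b ->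
  (forall j : 'I_q, good j -> dropping (j * n.+2)%N%:Z) ->
  \sum_(k <- rng 0 (q * n.+2)) gapd (x (t + h)) k + \sum_(j < q) (good j)%:R <=
  \sum_(k <- rng 0 (q * n.+2)) gapd (x t) k + 2 * K%:R.
Proof.
move=> Ka a0 Nb bK qa qb hgood.
have th : t <= t + h by rewrite lerDl mulr_ge0.
have ab : a < b by lia.
have [u [hu hg]] := gapd_quiet_window t0 th ab qa qb.
have block_in (j : 'I_q) : a < (j * n.+2)%N%:Z /\ (j * n.+2)%N%:Z + n.+1%:Z < b.
  by have := ltn_ord j; split; nia.
have l2 : (1 < n.+2)%N by [].
apply: (block_drop mu_gt0 mu_le l2 Ka a0 Nb bK (c := c) (u := u)) => //.
- by move=> p pu; have [_ _ hin] := hu; have [] := hin _ pu.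
- move=> p j pu /hgood[_ q1 q2 _]; split; first exact: word_quiet hu q1 pu.
  rewrite (_ : _ + _ - 1 = (j * n.+2)%N%:Z + n.+1%:Z); last by lia.
  exact: word_quiet hu q2 pu.
- by move=> j /hgood[].
- move=> j gj; have [h1 h2] := block_in j.
  exact: dropping_mass h1 h2 qa qb (hgood j gj).
Qed.

End pathwise_drop.

(** * Probability that a block loses mass *)

Section dropping_probability.
Context {d : measure_display} {T : measurableType d} {R : realType}.
Variables (P : probability T R) (mu : R) (gap coin : int -> nat -> {RV P >-> R})
  (eta : R -> int -> {RV P >-> R}).
Hypothesis heta : compass_model mu gap coin eta.
Notation conf := (@config R idx).
Notation X := (source eta gap coin).
Implicit Types (y : conf).
Let dX := model_driving heta.
Let mP := measurable_joint_preimage X.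

Lemma union_bound (J : choiceType) (s : seq J) (B : J -> set T) (x : R) : 0 <= x ->
  (forall j, measurable (B j)) -> (forall j, j \in s -> (P (B j) <= x%:E)%E) ->
  (P [set w | exists2 j, j \in s & B j w] <= ((size s)%:R * x)%:E)%E.
Proof.
move=> x0 mB; elim: s => [|j s IH] hB.
  rewrite (_ : [set w | _] = set0) ?measure0 ?mul0r //.
  by apply/seteqP; split => w // [].
have -> : [set w | exists2 i, i \in j :: s & B i w] = B j `|` [set w | exists2 i, i \in s & B i w].
  apply/seteqP; split => w /=.
    by move=> [i]; rewrite inE => /orP[/eqP ->|si] Bi; [left|right; exists i].
  by case=> [Bj|[i si Bi]]; [exists j; rewrite ?mem_head|exists i; rewrite ?inE ?si ?orbT].
have ms : measurable [set w | exists2 i, i \in s & B i w].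
  have -> : [set w | exists2 i, i \in s & B i w] = \big[setU/set0]_(i <- s) B i.
    by rewrite -bigcup_seq; apply/seteqP; split => w [i si Bi]; exists i.
  exact: bigsetU_measurable.
apply: le_trans (measureU2 _ (mB j) ms) _.
rewrite (_ : (size (j :: s))%:R * x = x + (size s)%:R * x); last first.
  by rewrite /= -addn1 natrD; ring.
rewrite EFinD; apply: leeD.
  by apply: hB; rewrite mem_head.
by apply: IH => i si; apply: hB; rewrite inE si orbT.
Qed.

Lemma quiet_probability t S e : 0 <= t -> 0 <= S ->
  P (joint X @^-1` [set y | quiet (ctau y) t (t + S) e]) = (expR (- S))%:E.
Proof.
move=> t0 S0; have := quiet_prob dX (H := setT) (e := e) t0 S0 measurableT (fun _ _ _ _ _ _ _ _ => I).
by rewrite setTI preimage_setT probability_setT mule1.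
Qed.

Variables (t S : R) (r n : nat) (c0 : int).
Hypotheses (t0 : 0 <= t) (S0 : 0 <= S).
Let h := r%:R * S.
Let h0 : 0 <= h. Proof. by rewrite mulr_ge0. Qed.

Definition heavy : set T := [set w | 4 <= \sum_(k <- rng c0 n.+2) gapd (fun v => eta t v w) k].

Definition drops : set T :=
  [set w | dropping (ctau (joint X w)) (fun s v => eta s v w) t S r n c0].

Let Phi (x z : int -> R) : R := \sum_(k <- rng c0 n.+2) gapd x k.

Let lPhi : local_on c0 (c0 + n.+2%:Z) Phi.
Proof.
move=> x x' z z' hx _; apply: eq_big_seq => k; rewrite mem_rng => hk.
by rewrite /gapd !hx //; lia.
Qed.

Let mPhi : measurable_functional Phi.
Proof.
move=> d' T' p q mp mq; apply: measurable_sum => k.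
by apply: measurable_arc; exact: measurable_funB.
Qed.

Let A := [set z : R | 4 <= z].
Let mA : measurable A.
Proof. by rewrite /A -set_itvcy; exact: measurable_itv. Qed.

Let Obs : set conf := obs mu c0 (c0 + n.+2%:Z) Phi A t t.
Let mObs : measurable Obs. Proof. exact: measurable_obs. Qed.

Let busy : set conf := [set y | forall q : int * nat, q.1 \in rng (c0 + 1) n -> (q.2 < r)%N ->
  ~ quiet (ctau y) (t + q.2%:R * S) (t + q.2.+1%:R * S) q.1].

Let mbusy : measurable busy.
Proof.
apply: measurable_forall => q; apply: measurable_imply; apply: measurable_imply.
by apply: measurableC; exact: measurable_quiet.
Qed.

Let guard e : set conf := [set y | quiet (ctau y) t (t + h) e].
Let mguard e : measurable (guard e). Proof. exact: measurable_quiet. Qed.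

Let heavy_obs : {ae P, forall w, (joint X @^-1` Obs) w <-> heavy w}.
Proof. by apply: (obs_ae A heta _ lPhi t0 t0); rewrite lerDl. Qed.

Lemma measurable_heavy : measurable heavy.
Proof.
apply: measurable_le; first exact: measurable_cst.
by apply: measurable_sum => k; apply: measurable_arc; apply: measurable_funB; exact: measurable_funPT.
Qed.

Let dropsE : drops = heavy `&` (joint X @^-1` (guard c0 `&` guard (c0 + n.+1%:Z) `&` busy)).
Proof.
apply/seteqP; split => w.
  by move=> [h1 h2 h3 h4]; split => //; split => // q; exact: h4.
by move=> [h1 [[h2 h3] h4]]; split => // k i; exact: (h4 (k, i)).
Qed.

Lemma measurable_drops : measurable drops.
Proof.
rewrite dropsE; apply: measurableI; first exact: measurable_heavy.
by apply: mP; apply: measurableI => //; exact: measurableI.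
Qed.

Let H0 := Obs `&` busy.

Let busy_updated y e m x x' : e \notin rng (c0 + 1) n ->
  busy (updated y e m x) -> busy (updated y e m x').
Proof.
move=> en hb q qn qr qq; apply: (hb q qn qr) => i; have := qq i.
have qe : q.1 != e by apply: contraNneq en => <-.
by rewrite !ctau_updated_neq.
Qed.

Let H0_past e y m x x' : e \notin rng (c0 + 1) n -> H0 (updated y e m x) -> 0 < x' ->
  t < ctau (updated y e m x) e m -> t < ctau (updated y e m x') e m ->
  H0 (updated y e m x').
Proof.
move=> en [ho hb] x'0 t1 t2; split; last exact: busy_updated hb.
exact: obs_past (lexx t) (lexx t) ho x'0 t1 t2.
Qed.

(** The mass at time [t] is decided by events up to [t], and [busy] by the core clocks. So
    [quiet_prob] applies to the two guards in turn, each contributing [expR (- h)]. *)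
Lemma drops_probability :
  P drops = ((expR (- (h + h)))%:E * P (joint X @^-1` H0))%E.
Proof.
have g1 : c0 \notin rng (c0 + 1) n by rewrite mem_rng; lia.
have g2 : c0 + n.+1%:Z \notin rng (c0 + 1) n by rewrite mem_rng; lia.
have q1 := quiet_prob dX (H := H0) (e := c0) t0 h0 (measurableI _ _ mObs mbusy)
  (fun y m x x' => H0_past g1).
have q2 : P (joint X @^-1` ((H0 `&` guard c0) `&` guard (c0 + n.+1%:Z))) =
    ((expR (- h))%:E * P (joint X @^-1` (H0 `&` guard c0)))%E.
  apply: (quiet_prob dX (H := H0 `&` guard c0) (e := c0 + n.+1%:Z) t0 h0).
    by apply: measurableI => //; exact: measurableI.
  move=> y m x x' [h1 h2] x'0 t1 t2; split; first exact: H0_past h1 x'0 t1 t2.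
  move=> i; have := h2 i; rewrite !ctau_updated_neq //; apply/eqP; lia.
rewrite opprD expRD EFinM -muleA -q1 -q2.
apply: measure_ae_eq; first exact: measurable_drops.
  by apply: mP; apply: measurableI => //; apply: measurableI => //; exact: measurableI.
rewrite dropsE; apply: filterS heavy_obs => w ho; split.
  by move=> [h1 [[h2 h3] h4]]; split => //; split => //; split => //; apply/ho.
by move=> [[[h1 h2] h3] h4]; split; [apply/ho|].
Qed.

(** If the core is not busy, one of the [n * r] pairs of a core edge and a slot is quiet, and each
    is so with probability [expR (- S)]. *)
Lemma heavy_probability :
  (P heavy <= P (joint X @^-1` H0) + ((n * r)%:R * expR (- S))%:E)%E.
Proof.
pose s := [seq (k, i) | k <- rng (c0 + 1) n, i <- iota 0 r].
pose B (q : int * nat) := joint X @^-1`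
   [set y : conf | quiet (ctau y) (t + q.2%:R * S) (t + q.2.+1%:R * S) q.1].
have sz : size s = (n * r)%N by rewrite size_allpairs size_map !size_iota.
have mB q : measurable (B q) by apply: mP; exact: measurable_quiet.
have hB q : q \in s -> (P (B q) <= (expR (- S))%:E)%E.
  move=> _; rewrite -(@quiet_probability (t + q.2%:R * S) S q.1) //; last first.
    by rewrite addr_ge0 // mulr_ge0.
  by rewrite /B -addn1 natrD mulrDl mul1r addrA.
have mU : measurable [set w | exists2 q, q \in s & B q w].
  have -> : [set w | exists2 q, q \in s & B q w] = \big[setU/set0]_(i <- s) B i.
    by rewrite -bigcup_seq; apply/seteqP; split => w [i si Bi]; exists i.
  exact: bigsetU_measurable.
have mH0 : measurable (joint X @^-1` H0) by apply: mP; exact: measurableI.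
apply: (@le_trans _ _ (P (joint X @^-1` H0) + P [set w | exists2 q, q \in s & B q w])%E).
  apply: le_trans (measureU2 _ mH0 mU).
  have -> : P heavy = P (joint X @^-1` Obs).
    apply: measure_ae_eq; [exact: measurable_heavy|exact: mP|].
    by apply: filterS heavy_obs => w [? ?]; split.
  apply: le_measure; rewrite ?inE; [exact: mP|exact: measurableU|].
  move=> w ho; have [hb|/existsNP[q]] := pselect (busy (joint X w)); first by left.
  move=> /not_implyP[qn /not_implyP[qr /contrapT qq]]; right; exists q => //.
  by apply/allpairsP; exists q; split; rewrite ?mem_iota //; case: q {qn qr qq}.
rewrite leeD2l // -sz; apply: union_bound => //; exact: expR_ge0.
Qed.

Lemma drops_lower_bound (x z : R) : (x%:E <= P heavy)%E -> (n * r)%:R * expR (- S) <= z ->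
  ((expR (- (h + h)) * (x - z))%:E <= P drops)%E.
Proof.
move=> hx hz; rewrite drops_probability EFinM; apply: lee_wpmul2l.
  by rewrite lee_fin expR_ge0.
have mH0 : P (joint X @^-1` H0) \is a fin_num.
  by apply: fin_num_measure; apply: mP; exact: measurableI.
move: (le_trans hx heavy_probability); rewrite -(fineK mH0) -EFinD !lee_fin; lra.
Qed.

End dropping_probability.

Section means.
Context {d : measure_display} {T : measurableType d} {R : realType}.
Variable P : probability T R.
Implicit Types (g h : T -> R).

Definition mean g : \bar R := \int[P]_w (g w)%:E.

Lemma mean_ge0 g : (forall w, 0 <= g w) -> (0 <= mean g)%E.
Proof. by move=> g0; apply: integral_ge0 => w _; rewrite lee_fin. Qed.

Lemma meanD g h : measurable_fun setT g -> measurable_fun setT h ->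
  (forall w, 0 <= g w) -> (forall w, 0 <= h w) ->
  mean (fun w => g w + h w) = (mean g + mean h)%E.
Proof.
move=> mg mh g0 h0; rewrite /mean; under eq_integral do rewrite EFinD.
by rewrite ge0_integralD //; (try by move=> w _; rewrite lee_fin); exact/measurable_EFinP.
Qed.

Lemma mean_sum (J : Type) (s : seq J) (g : J -> T -> R) :
  (forall j, measurable_fun setT (g j)) -> (forall j w, 0 <= g j w) ->
  mean (fun w => \sum_(j <- s) g j w) = (\sum_(j <- s) mean (g j))%E.
Proof.
move=> mg g0; rewrite /mean; under eq_integral do rewrite -sumEFin.
rewrite ge0_integral_sum //; first by move=> j; exact/measurable_EFinP.
by move=> j w _; rewrite lee_fin.
Qed.

Lemma mean_cst (r : R) : mean (fun=> r) = r%:E.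
Proof.
rewrite /mean integral_cst // [X in (_ * X)%E](_ : _ = 1%E) ?mule1 //.
exact: probability_setT.
Qed.

Lemma mean_indic (A : set T) (r : R) : 0 <= r -> measurable A ->
  mean (fun w => r * \1_A w) = (r%:E * P A)%E.
Proof.
move=> r0 mA; rewrite /mean; under eq_integral do rewrite EFinM.
rewrite ge0_integralZl //; first by rewrite integral_indic // setIT.
exact/measurable_EFinP.
Qed.

Lemma mean_le_ae g h : measurable_fun setT g -> measurable_fun setT h ->
  (forall w, 0 <= g w) -> (forall w, 0 <= h w) ->
  {ae P, forall w, g w <= h w} -> (mean g <= mean h)%E.
Proof.
move=> mg mh g0 h0 gh; apply: ae_ge0_le_integral => //.
- by move=> w _; rewrite lee_fin.
- exact/measurable_EFinP.
- by move=> w _; rewrite lee_fin.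
- exact/measurable_EFinP.
by apply: filterS gh => w gw _; rewrite lee_fin.
Qed.

Lemma mean_same_law (g h : {RV P >-> R}) : (forall w, 0 <= g w) -> (forall w, 0 <= h w) ->
  (forall A : set R, measurable A -> P [set w | A (g w)] = P [set w | A (h w)]) ->
  mean g = mean h.
Proof.
move=> g0 h0 gh.
have key (f : {RV P >-> R}) : (forall w, 0 <= f w) ->
    mean f = (\int[distribution P f]_y `|y|%:E)%E.
  move=> f0; rewrite ge0_integral_distribution.
  - by apply: eq_integral => w _; rewrite /= ger0_norm.
  - by apply/measurable_EFinP; exact: normr_measurable.
  - by move=> y; rewrite lee_fin.
rewrite !key //; apply: eq_measure_integral => A mA _; exact: gh.
Qed.

End means.

Lemma archimedean_le0 (R : realType) (y x : R) : (forall q : nat, q%:R * x <= y) -> x <= 0.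
Proof.
move=> h; rewrite leNgt; apply/negP => x0.
have y0 : 0 <= y by have := h 0%N; rewrite mul0r.
have := archi_boundP (divr_ge0 y0 (ltW x0)); rewrite ltr_pdivrMr // ltNge => /negP; apply.
exact: h.
Qed.

(** * Decay of the mean mass of an edge *)

Section mean_gap.
Context {d : measure_display} {T : measurableType d} {R : realType}.
Variables (P : probability T R) (mu : R) (gap coin : int -> nat -> {RV P >-> R})
  (eta : R -> int -> {RV P >-> R}).
Hypothesis heta : compass_model mu gap coin eta.
Hypotheses (mu_gt0 : 0 < mu) (mu_le : mu <= 2^-1).
Notation X := (source eta gap coin).
Implicit Types (t s : R) (v k : int).
Let dX := model_driving heta.

Definition distance_RV (A B : {RV P >-> R}) : T -> R := fun w => arc (B w - A w).

Let measurable_distance_RV (A B : {RV P >-> R}) : measurable_fun setT (distance_RV A B).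
Proof. by apply: measurable_arc; apply: measurable_funB; exact: measurable_funPT. Qed.

HB.instance Definition _ (A B : {RV P >-> R}) :=
  isMeasurableFun.Build _ _ _ _ (distance_RV A B) (measurable_distance_RV A B).

Let gapw t v : {RV P >-> R} := distance_RV (eta t v) (eta t (v + 1)).

Definition mean_gap t : R := fine (mean P (gapw t 0)).

Lemma mean_gapE t v : 0 <= t -> mean P (gapw t v) = (mean_gap t)%:E.
Proof.
move=> t0; rewrite /mean_gap fineK; last first.
  rewrite ge0_fin_numE; last by apply: mean_ge0 => w; exact: arc_ge0.
  apply: (@le_lt_trans _ _ (mean P (fun=> 1))); last by rewrite mean_cst ltry.
  apply: mean_le_ae => // [w|]; first exact: arc_ge0.
  by apply: aeW => w; exact: arc_le1.
apply: mean_same_law => [w|w|A mA]; try exact: arc_ge0.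
have h := @law_shift _ _ _ P mu gap coin eta v 0 1 (fun x z => gapd x 0) A t t heta.
have {}h := h ler01 _ _ mA t0 t0.
have -> : P [set w | A (gapw t 0 w)] = P [set w | A (gapd (fun u => eta t u w) 0)] by [].
rewrite -h; last 2 first.
- by move=> x x' z z' hx _; rewrite /gapd !hx.
- by move=> d' T' p q mp mq; apply: measurable_arc; exact: measurable_funB.
congr (P _); apply/funext => w; rewrite /= /gapd.
by rewrite (_ : 0 + v = v) 1?(_ : 0 + 1 + v = v + 1) //; ring.
Qed.

Lemma mean_gap_ge0 t : 0 <= mean_gap t.
Proof. by apply: fine_ge0; apply: mean_ge0 => w; exact: arc_ge0. Qed.

Lemma mean_gap_le1 t : 0 <= t -> mean_gap t <= 1.
Proof.
move=> t0; rewrite -lee_fin -(mean_gapE 0 t0) -(mean_cst P 1).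
apply: mean_le_ae => // [w|]; first exact: arc_ge0.
by apply: aeW => w; exact: arc_le1.
Qed.

Let mass t c l : T -> R := fun w => \sum_(k <- rng c l) gapd (fun u => eta t u w) k.

Let measurable_mass t c l : measurable_fun setT (mass t c l).
Proof. by apply: measurable_sum => k; exact: (measurable_funPT (gapw t k)). Qed.

Let mass_ge0 t c l w : 0 <= mass t c l w.
Proof. by apply: sumr_ge0 => k _; exact: arc_ge0. Qed.

Let mass_le t c l w : mass t c l w <= l%:R.
Proof.
have sz : size (rng c l) = l by rewrite size_map size_iota.
rewrite -[in leRHS]sz -sum1_size natr_sum; apply: ler_sum => k _; exact: arc_le1.
Qed.

Lemma mean_mass t c l : 0 <= t -> mean P (mass t c l) = (l%:R * mean_gap t)%:E.
Proof.
move=> t0; rewrite (mean_sum _ _ (g := fun k w => gapd (fun u => eta t u w) k)).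
- rewrite (eq_bigr (fun=> (mean_gap t)%:E)) => [|k _]; last exact: mean_gapE.
  rewrite sumEFin big_const_seq count_predT size_map size_iota iter_addr_0.
  by rewrite mulr_natl.
- by move=> k; exact: (measurable_funPT (gapw t k)).
- by move=> k w; exact: arc_ge0.
Qed.

Section step.
Variables (t S : R) (r n : nat) (kappa : R).
Hypotheses (t0 : 0 <= t) (S0 : 0 <= S) (r0 : (0 < r)%N)
  (hr : (n ^ 3)%:R <= 2 * mu * r%:R).
Let h := r%:R * S.
Let dropsw (c0 : int) := drops gap coin eta t S r n c0.
Hypothesis hkappa : forall c0, (kappa%:E <= P (dropsw c0))%E.

Let rho := 1 - expR (- (t + h)).
Let h0 : 0 <= h. Proof. by rewrite mulr_ge0. Qed.
Let th0 : 0 <= t + h. Proof. by rewrite addr_ge0. Qed.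

(** Expectation of the pathwise balance over [q] blocks. The margins cost [2 * K%:R]; the event that
    one of them has no quiet edge has probability at most [2 * rho ^+ K]. *)
Let window_step q K :
  (q * n.+2)%:R * mean_gap (t + h) + q%:R * kappa <=
  (q * n.+2)%:R * mean_gap t + (2 * K%:R + 2 * (q * n.+2)%:R * (2 * rho ^+ K)).
Proof.
set N := (q * n.+2)%N.
pose left (j : nat) : int := - 1 - j%:Z; pose right (j : nat) : int := N%:Z + j%:Z.
have left_inj : injective left by move=> i j; rewrite /left; lia.
have right_inj : injective right by move=> i j; rewrite /right; lia.
pose bad f := joint X @^-1` ~` quiet_among f (t + h) K.
have mbad f : measurable (bad f).
  by apply: measurable_joint_preimage; apply: measurableC; exact: measurable_quiet_among.
pose B := bad left `|` bad right.
have mB : measurable B by exact: measurableU.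
have PB : (P B <= (2 * rho ^+ K)%:E)%E.
  apply: le_trans (measureU2 _ (mbad left) (mbad right)) _.
  rewrite (_ : 2 * rho ^+ K = rho ^+ K + rho ^+ K); last by ring.
  by rewrite EFinD; apply: leeD; apply: no_quiet_among.
pose D (j : 'I_q) := dropsw (j * n.+2)%N%:Z.
have mD j : measurable (D j) by exact: measurable_drops.
pose count w : R := \sum_(j < q) 1 * \1_(D j) w.
pose error w : R := 2 * K%:R + 2 * N%:R * \1_B w.
have mindic (C : set T) (c : R) : measurable C -> measurable_fun setT (fun w => c * \1_C w : R).
  by move=> mC; apply: measurable_funM => //; exact: measurable_indic.
have mcount : measurable_fun setT count by apply: measurable_sum => j; exact: mindic.
have merror : measurable_fun setT error by apply: measurable_funD => //; exact: mindic.
have count0 w : 0 <= count w by apply: sumr_ge0 => j _; rewrite mul1r.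
have error0 w : 0 <= error w by rewrite addr_ge0 ?mulr_ge0.
have step_ae : {ae P, forall w, mass (t + h) 0 N w + count w <= mass t 0 N w + error w}.
  apply: filterS3 (regular_ae dX) (coins_ae dX) (path_ae heta) => w rw cw pw.
  (* Without quiet edges nothing is known, but the mass and the count are at most [N] each, which
     the term [2 * N%:R] of [error] covers. *)
  have [wB|wB] := boolP (w \in B).
    rewrite /error indicE wB mulr1.
    have := mass_ge0 t 0 N w; have := mass_le (t + h) 0 N w.
    have : count w <= N%:R.
      apply: (@le_trans _ _ q%:R); last by rewrite ler_nat /N; nia.
      rewrite -[in leRHS](card_ord q) -sum1_card natr_sum; apply: ler_sum => j _.
      by rewrite mul1r indicE lern1 leq_b1.
    have : 0 <= K%:R :> R by [].
    lra.
  rewrite /error indicE (negPf wB) mulr0 addr0.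
  move: wB; rewrite notin_setE => /not_orP[/contrapT [i iK qi] /contrapT[j jK qj]].
  have sub e : quiet (ctau (joint X w)) 0 (t + h) e -> quiet (ctau (joint X w)) t (t + h) e.
    exact: quiet_sub t0 (lexx _).
  have := window_drop mu_gt0 mu_le rw (fun e m => cw (e, m)) pw t0 S0 r0 hr
    (q := q) (K := K) (a := left i) (b := right j) (good := fun j => w \in D j) _ _ _ _
    (sub _ qi) (sub _ qj) _.
  have -> : count w = \sum_(j < q) (w \in D j)%:R.
    by apply: eq_bigr => j' _; rewrite mul1r indicE.
  apply; rewrite /left /right; [lia|lia|lia|lia|].
  by move=> j'; rewrite inE.
have mm s : measurable_fun setT (mass s 0 N) by [].
have := mean_le_ae (P := P) (measurable_funD (mm _) mcount) (measurable_funD (mm _) merror)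
  (fun w => addr_ge0 (mass_ge0 _ _ _ w) (count0 w))
  (fun w => addr_ge0 (mass_ge0 _ _ _ w) (error0 w)) step_ae.
have sumE (s : R) (g : T -> R) : 0 <= s -> measurable_fun setT g -> (forall w, 0 <= g w) ->
    mean P (fun w => mass s 0 N w + g w) = ((N%:R * mean_gap s)%:E + mean P g)%E.
  by move=> s0 mg g0; rewrite meanD // -(mean_mass 0 N s0).
rewrite (sumE _ count th0) // (sumE _ error t0) //.
have -> : mean P error = ((2 * K%:R)%:E + (2 * N%:R)%:E * P B)%E.
  by rewrite /error (meanD _ _ (mindic _ _ mB)) ?mean_cst ?mean_indic.
have -> : mean P count = (\sum_(j < q) P (D j))%E.
  rewrite /count mean_sum => [|j|j w]; [|exact: mindic|by rewrite mul1r].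
  by apply: eq_bigr => j _; rewrite mean_indic // mul1e.
move=> hmean.
have : ((N%:R * mean_gap (t + h))%:E + (q%:R * kappa)%:E <=
   (N%:R * mean_gap t)%:E + ((2 * K%:R)%:E + (2 * N%:R)%:E * (2 * rho ^+ K)%:E))%E.
  apply: le_trans (le_trans hmean _).
    apply: leeD2l; have -> : (q%:R * kappa)%:E = (\sum_(j < q) kappa%:E)%E.
      by rewrite sumEFin big_const_ord iter_addr_0 mulr_natl.
    by apply: lee_sum => j _; exact: hkappa.
  by apply: leeD2l; apply: leeD2l; apply: lee_wpmul2l; rewrite ?lee_fin.
by rewrite -EFinM -!EFinD lee_fin.
Qed.

(** Two limits in [window_step]: [q] to infinity with [K] fixed removes the margins, then [K] to
    infinity removes the power of [rho < 1]. *)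
Lemma mean_gap_step : n.+2%:R * mean_gap (t + h) + kappa <= n.+2%:R * mean_gap t.
Proof.
have [rho0 rho1] : 0 <= rho /\ rho < 1.
  by rewrite gtrBl expR_gt0 subr_ge0 -expR0 ler_expR oppr_le0.
have hK K : n.+2%:R * mean_gap (t + h) + kappa - n.+2%:R * mean_gap t <=
    4 * n.+2%:R * rho ^+ K.
  rewrite -subr_le0; apply: (@archimedean_le0 _ (2 * K%:R)) => q.
  by have := window_step q K; rewrite natrM; nra.
rewrite -subr_le0; set z := _ - _ in hK *; rewrite leNgt; apply/negP => z0.
have c0 : 0 < 4 * n.+2%:R :> R by rewrite mulr_gt0.
have zc : 0 < z / (4 * n.+2%:R) by rewrite divr_gt0.
have : ((z / (4 * n.+2%:R))%:E = 0)%E.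
  apply: (@geometric_small _ _ rho); rewrite ?lee_fin ?rho0 ?ltW // => K.
  by rewrite lee_fin ler_pdivrMr // mulrC; exact: hK.
by move=> [] z1; rewrite z1 ltxx in zc.
Qed.

End step.

Lemma mean_gap_nonincreasing t s : 0 <= t -> t <= s -> mean_gap s <= mean_gap t.
Proof.
move=> t0 ts; have st0 : 0 <= s - t by rewrite subr_ge0.
(* Blocks of two edges with empty core, a single slot, and no guaranteed loss. *)
have := @mean_gap_step t (s - t) 1 0 0 t0 st0 isT.
rewrite mul1r subrKC addr0 exp0n // => h.
have := h _ (fun=> measure_ge0 _ _); rewrite ler_pM2l //; apply.
by rewrite !mulr_ge0 // ltW.
Qed.

Lemma mean_gap_drop m : 0 < m -> exists h kappa, [/\ 0 <= h, 0 < kappa &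
  forall t, 0 <= t -> m <= mean_gap t -> mean_gap (t + h) + kappa <= mean_gap t].
Proof.
move=> m0.
(* Blocks so long that the threshold 4, spread over a block, costs at most [m / 4] per edge. *)
have [n hn] : exists n : nat, 16 / m <= n.+2%:R.
  exists (Num.bound (16 / m)); apply: (@le_trans _ _ (Num.bound (16 / m))%:R).
    by rewrite ltW // archi_boundP // divr_ge0 // ltW.
  by rewrite ler_nat; lia.
have [r [r0 hr]] : exists r : nat, (0 < r)%N /\ (n ^ 3)%:R <= 2 * mu * r%:R.
  exists (Num.bound ((n ^ 3)%:R / (2 * mu))).+1; split => //.
  rewrite mulrC -ler_pdivrMr ?mulr_gt0 //.
  apply: (@le_trans _ _ (Num.bound ((n ^ 3)%:R / (2 * mu)))%:R).
    by rewrite ltW // archi_boundP // divr_ge0 // ltW // mulr_gt0.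
  by rewrite ler_nat.
(* Slots so long that the core fails to be busy with probability at most [m / 4]; the choice of [S]
   rests on [1 + S <= expR S]. *)
have [S [S0 hS]] : exists S : R, 0 <= S /\ (n * r)%:R * expR (- S) <= m / 4.
  pose S := (n * r)%:R / (m / 4); exists S; have S0 : 0 <= S by rewrite divr_ge0 // ltW // divr_gt0.
  split => //; rewrite expRN ler_pdivrMr ?expR_gt0 //.
  apply: (@le_trans _ _ (m / 4 * S)).
    by rewrite /S mulrC divfK // gt_eqF // divr_gt0.
  rewrite ler_pM2l ?divr_gt0 //.
  by have := expR_ge1Dx S; lra.
pose h := r%:R * S; have h0 : 0 <= h by rewrite mulr_ge0.
(* [m / 2] is [3 * m / 4] for a heavy block minus [m / 4] for a core that is not busy; the
   exponential pays for the two guards, and the loss per block is divided by the block length. *)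
exists h, (expR (- (h + h)) * (m / 2) / n.+2%:R).
split => // [|t t0 mt]; first by rewrite !divr_gt0 ?mulr_gt0 ?expR_gt0 ?divr_gt0.
have := @mean_gap_step t S r n (expR (- (h + h)) * (m / 2)) t0 S0 r0 hr.
have drops_ge c0 : ((expR (- (h + h)) * (m / 2))%:E <= P (drops gap coin eta t S r n c0))%E.
  have heavy_ge : ((m * 3 / 4)%:E <= P (heavy eta t n c0))%E.
    have mH : measurable (heavy eta t n c0) by exact: measurable_heavy.
    (* The block mass is at most 4 off the heavy event and at most [n.+2] on it, while its mean is
       at least [n.+2%:R * m]. *)
    have : (mean P (mass t c0 n.+2) <=
        mean P (fun w => (4 + n.+2%:R * \1_(heavy eta t n c0) w)%R))%E.
      have mI : measurable_fun setT (fun w => n.+2%:R * \1_(heavy eta t n c0) w : R).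
        by apply: measurable_funM => //; exact: measurable_indic.
      apply: mean_le_ae => //; first exact: measurable_funD.
      apply: aeW => w; rewrite indicE.
      have [_|] := boolP (w \in heavy eta t n c0).
        by rewrite mulr1; have := mass_le t c0 n.+2 w; lra.
      by rewrite mulr0 addr0 notin_setE /heavy /= => /negP; rewrite -ltNge => /ltW.
    rewrite mean_mass // meanD ?mean_cst ?mean_indic //; last first.
      by apply: measurable_funM => //; exact: measurable_indic.
    rewrite -(fineK (fin_num_measure P _ mH)) -EFinM -EFinD !lee_fin.
    set p := fine _ => hp1; have l0 : 0 < n.+2%:R :> R by rewrite ltr0n.
    have : 16 <= m * n.+2%:R by rewrite mulrC -ler_pdivrMr.
    rewrite -(ler_pM2l l0); nra.
  rewrite (_ : m / 2 = m * 3 / 4 - m / 4); last by field.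
  exact: (drops_lower_bound heta t0 S0 heavy_ge hS).
move=> /(_ drops_ge) hs; have l0 : 0 < n.+2%:R :> R by rewrite ltr0n.
by rewrite -(ler_pM2l l0) mulrDr [n.+2%:R * (_ / _)]mulrC divfK // gt_eqF.
Qed.

(** Were the mean at least [m] forever, repeated drops by [kappa] would make it negative; once below
    [m] it stays there by monotonicity. *)
Lemma mean_gap_small m : 0 < m -> exists M, forall t, M <= t -> 0 <= t -> mean_gap t < m.
Proof.
move=> m0; have [h [kappa [h0 k0 hdrop]]] := mean_gap_drop m0.
have [M [M0 hM]] : exists M, 0 <= M /\ mean_gap M < m.
  apply: contrapT => hn.
  have big t : 0 <= t -> m <= mean_gap t.
    by move=> t0; rewrite leNgt; apply/negP => tm; apply: hn; exists t.
  have iter_drop i : mean_gap (i%:R * h) + i%:R * kappa <= 1.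
    elim: i => [|i IH]; first by rewrite !mul0r addr0 mean_gap_le1.
    have ih0 : 0 <= i%:R * h by rewrite mulr_ge0.
    have := hdrop _ ih0 (big _ ih0); rewrite -[i.+1]addn1 natrD !mulrDl !mul1r; lra.
  have : kappa <= 0.
    apply: (@archimedean_le0 _ 1) => q; have := iter_drop q.
    by have := mean_gap_ge0 (q%:R * h); lra.
  by rewrite leNgt k0.
exists M => t Mt t0; apply: le_lt_trans hM; exact: mean_gap_nonincreasing.
Qed.

Lemma weak_consensus v :
  'E_P[(fun w => circle_dist (eta t v w) (eta t (v + 1)%R w))]%E @[t --> +oo] --> 0%E.
Proof.
have hcirc : forall t u w, 0 <= t -> eta t u w \in `]-1, 1] by case: heta.
have eE t : 0 <= t -> ('E_P[(fun w => circle_dist (eta t v w) (eta t (v + 1)%R w))]%E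
    = (mean_gap t)%:E).
  move=> t0; rewrite -(mean_gapE v t0) unlock; apply: eq_integral => w _.
  by rewrite circle_distE ?hcirc.
have ge_near (M : R) : \forall t \near +oo, M <= t.
  by apply: nbhs_pinfty_ge; rewrite num_real.
apply: (@cvg_trans _ ((mean_gap t)%:E @[t --> +oo])).
  by apply: near_eq_cvg; apply: filterS (ge_near 0) => t /eE ->.
apply: cvg_EFin; first exact: nearW.
apply/cvgrPdist_lt => e e0; have [M hM] := mean_gap_small e0.
apply: filterS2 (ge_near M) (ge_near 0) => t Mt t0.
by rewrite /= sub0r normrN ger0_norm ?mean_gap_ge0 //; exact: hM.
Qed.

End mean_gap.

Theorem theorem1p1 (R : realType) (d : measure_display) (T : measurableType d)
    (P : probability T R) (mu : R) (hmu0 : 0 < mu) (hmu : mu <= 2^-1)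
    (gap coin : int -> nat -> {RV P >-> R}) (eta : R -> int -> {RV P >-> R})
    (heta : compass_model mu gap coin eta) :
  (forall v : int,
     'E_P[(fun w => circle_dist (eta t v w) (eta t (v + 1)%R w))]%E
       @[t --> +oo] --> 0%E)
  /\
  ~ (exists L : {RV P >-> R},
       (forall w, L w \in `]-1, 1]) /\
       (forall v : int,
          cvg_to0_in_probability P (fun t w => circle_dist (eta t v w) (L w)))).
Proof.
split; last exact: no_strong_consensus heta.
by move=> v; exact: weak_consensus heta hmu0 hmu v.
Qed.
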